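(* Let $E$ be an arbitrary directed graph and $K$ a field with involution. The following are equivalent: (1) $E$ is row-finite, no-exit, and every infinite path of $E$ ends in a sink or a cycle; (2) $L_K(E)$ is locally Baer; (3) $L_K(E)$ is graded locally Baer. If $K$ is positive definite, these are also equivalent to (4) $L_K(E)$ is a graded locally Baer $*$-ring. Consequently, the following are equivalent: (1') $E$ is finite and no-exit; (2') $L_K(E)$ is a Baer ring; (3') $L_K(E)$ is a graded Baer ring; and, if $K$ is positive definite, (4') $L_K(E)$ is a graded Baer $*$-ring.
   Context: Directed graph $E=(E^0,E^1,s,r)$ of arbitrary cardinality. A vertex $v$ is regular if $s^{-1}(v)$ is nonempty and finite, a sink if $s^{-1}(v)=\emptyset$. $E$ is row-finite if every vertex is regular or a sink, and finite if row-finite with $E^0$ finite. A path is $e_1\cdots e_n$ with $r(e_i)=s(e_{i+1})$; a cycle is a closed path ($s(e_1)=r(e_n)$, $n\ge1$) with $s(e_i)\ne s(e_j)$ for $i\ne j$. $E$ is no-exit if every vertex visited by a cycle emits exactly one edge. An infinite path $e_1e_2\cdots$ ends in a sink or a cycle if some tail $e_ne_{n+1}\cdots$ either contains no cycles and no vertex on it emits an edge other than the next edge of the path, or equals $ccc\cdots$ for a cycle $c$. $L_K(E)$: free $K$-algebra on $E^0\cup E^1\cup\{e^*\}$ modulo $vw=\delta_{v,w}v$; $s(e)e=er(e)=e$; $r(e)e^*=e^*s(e)=e^*$; $e^*f=\delta_{e,f}r(e)$; $v=\sum_{e\in s^{-1}(v)}ee^*$ for regular $v$; $\mathbb Z$-graded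 with $\deg(ab^* )=|a|-|b|$; $*$-algebra via $(\sum k_ia_ib_i^* )^*=\sum k_i^*b_ia_i^*$. $K$ positive definite: $\sum k_ik_i^*=0\Rightarrow$ all $k_i=0$. A unital ring is Baer if the right annihilator of every subset is generated by an idempotent; graded Baer if unital and the right annihilator of every set of homogeneous elements is generated by a homogeneous idempotent; a graded Baer $*$-ring if the right annihilator of every set of homogeneous elements is generated by a homogeneous projection ($p=p^2=p^*$). Locally Baer: $eAe$ Baer for every idempotent $e$; graded locally Baer: $eAe$ graded Baer for every homogeneous idempotent $e$; graded locally Baer $*$-ring: $pAp$ a graded Baer $*$-ring for every homogeneous projection $p$. *)

(* Defs.v *)
(* Leavitt path algebras L_K(E) of arbitrary graphs, built
   as the free (non-unital) K-algebra on E^0 ∪ E^1 ∪ (E^1)^* modulo the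
   two-sided ideal generated by the Leavitt relations, presented as a
   syntactic setoid (terms modulo an inductively generated congruence). *)
From HB Require Import structures.
From mathcomp Require Import all_boot all_order all_algebra.
From Stdlib Require List.
Set Implicit Arguments. Unset Strict Implicit. Unset Printing Implicit Defensive.
Import GRing.Theory.

Section Graph.
Variables (V Ed : Type) (s r : Ed -> V).

Definition sink (v : V) : Prop := forall e, s e <> v.

Definition regular (v : V) : Prop :=
  exists l : list Ed, l <> nil /\ List.NoDup l /\ (forall e, s e = v <-> List.In e l).

Definition row_finite : Prop := forall v, regular v \/ sink v.

Definition finite_graph : Prop :=
  row_finite /\ exists l : list V, forall v, List.In v l.

Fixpoint epath (p : list Ed) : Prop :=
  match p with
  | e :: ((f :: _) as q) => r e = s f /\ epath q
  | _ => True
  end.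

Definition is_cycle (c : list Ed) : Prop :=
  match c with
  | nil => False
  | e :: c' => epath c /\ s e = r (last e c') /\ List.NoDup (List.map s c)
  end.

Definition no_exit : Prop :=
  forall c, is_cycle c -> forall e, List.In e c -> forall f, s f = s e -> f = e.

Definition inf_path (p : nat -> Ed) : Prop := forall n, r (p n) = s (p n.+1).

Definition ends_in_sink_or_cycle (p : nat -> Ed) : Prop :=
  exists n,
    ((forall i k, n <= i -> ~ is_cycle (List.map p (iota i k))) /\
     (forall m f, n <= m -> s f = s (p m) -> f = p m))
    \/
    (exists c, is_cycle c /\ forall k, p (n + k) = nth (p n) c (k %% size c)).

Definition all_inf_paths_end : Prop :=
  forall p, inf_path p -> ends_in_sink_or_cycle p.
End Graph.

Inductive lterm (V Ed K : Type) : Type :=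
  | LV : V -> lterm V Ed K
  | LE : Ed -> lterm V Ed K
  | LS : Ed -> lterm V Ed K           (* ghost edge e^* *)
  | L0 : lterm V Ed K
  | LAdd : lterm V Ed K -> lterm V Ed K -> lterm V Ed K
  | LScal : K -> lterm V Ed K -> lterm V Ed K
  | LMul : lterm V Ed K -> lterm V Ed K -> lterm V Ed K.
Arguments LV {V Ed K}. Arguments LE {V Ed K}. Arguments LS {V Ed K}.
Arguments L0 {V Ed K}.

Section Leavitt.
Variables (V Ed : Type) (s r : Ed -> V) (K : fieldType).
Local Notation T := (lterm V Ed K).
Local Open Scope ring_scope.

Definition lsum (l : list T) : T := List.fold_right (@LAdd V Ed K) L0 l.

Inductive leq : T -> T -> Prop :=
  | leq_refl x : leq x x
  | leq_sym x y : leq x y -> leq y x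
  | leq_trans x y z : leq x y -> leq y z -> leq x z
  | leq_add x x' y y' : leq x x' -> leq y y' -> leq (LAdd x y) (LAdd x' y')
  | leq_scal k x x' : leq x x' -> leq (LScal k x) (LScal k x')
  | leq_mul x x' y y' : leq x x' -> leq y y' -> leq (LMul x y) (LMul x' y')
  | leq_addA x y z : leq (LAdd x (LAdd y z)) (LAdd (LAdd x y) z)
  | leq_addC x y : leq (LAdd x y) (LAdd y x)
  | leq_add0 x : leq (LAdd L0 x) x
  | leq_addN x : leq (LAdd x (LScal (-1) x)) L0
  | leq_scalDr k x y : leq (LScal k (LAdd x y)) (LAdd (LScal k x) (LScal k y))
  | leq_scalDl k l x : leq (LScal (k + l) x) (LAdd (LScal k x) (LScal l x))
  | leq_scalA k l x : leq (LScal (k * l) x) (LScal k (LScal l x))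
  | leq_scal1 x : leq (LScal 1 x) x
  | leq_mulA x y z : leq (LMul x (LMul y z)) (LMul (LMul x y) z)
  | leq_mulDl x y z : leq (LMul (LAdd x y) z) (LAdd (LMul x z) (LMul y z))
  | leq_mulDr x y z : leq (LMul x (LAdd y z)) (LAdd (LMul x y) (LMul x z))
  | leq_scalMl k x y : leq (LMul (LScal k x) y) (LScal k (LMul x y))
  | leq_scalMr k x y : leq (LMul x (LScal k y)) (LScal k (LMul x y))
  | leq_vv v : leq (LMul (LV v) (LV v)) (LV v)
  | leq_vw v w : v <> w -> leq (LMul (LV v) (LV w)) L0
  | leq_se e : leq (LMul (LV (s e)) (LE e)) (LE e)
  | leq_er e : leq (LMul (LE e) (LV (r e))) (LE e)
  | leq_rs e : leq (LMul (LV (r e)) (LS e)) (LS e)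
  | leq_ss e : leq (LMul (LS e) (LV (s e))) (LS e)
  | leq_ck1 e : leq (LMul (LS e) (LE e)) (LV (r e))
  | leq_ck1' e f : e <> f -> leq (LMul (LS e) (LE f)) L0
  | leq_ck2 v (l : list Ed) : l <> nil -> List.NoDup l ->
      (forall e, s e = v <-> List.In e l) ->
      leq (LV v) (lsum (List.map (fun e => LMul (LE e) (LS e)) l)).

Local Infix "≈" := leq (at level 70).

Inductive hom : int -> T -> Prop :=
  | hom_V v : hom 0 (LV v)
  | hom_E e : hom 1 (LE e)
  | hom_S e : hom (-1) (LS e)
  | hom_0 n : hom n L0
  | hom_add n x y : hom n x -> hom n y -> hom n (LAdd x y)
  | hom_scal n k x : hom n x -> hom n (LScal k x)
  | hom_mul m n x y : hom m x -> hom n y -> hom (m + n) (LMul x y)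
  | hom_eq n x y : hom n x -> x ≈ y -> hom n y.

Definition homogeneous (x : T) : Prop := exists n, hom n x.

Fixpoint lstar (conj : K -> K) (x : T) : T :=
  match x with
  | LV v => LV v
  | LE e => LS e
  | LS e => LE e
  | L0 => L0
  | LAdd x y => LAdd (lstar conj x) (lstar conj y)
  | LScal k x => LScal (conj k) (lstar conj x)
  | LMul x y => LMul (lstar conj y) (lstar conj x)
  end.

Definition idem (x : T) : Prop := LMul x x ≈ x.
Definition proj (conj : K -> K) (x : T) : Prop := idem x /\ lstar conj x ≈ x.

Definition corner (e y : T) : Prop := y ≈ LMul (LMul e y) e.

Definition rann_in (e : T) (S : T -> Prop) (y : T) : Prop :=
  corner e y /\ forall x, S x -> LMul x y ≈ L0.

Definition rgen_in (e f y : T) : Prop := exists z, corner e z /\ y ≈ LMul f z.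

Definition corner_Baer (e : T) : Prop :=
  forall S : T -> Prop, (forall x, S x -> corner e x) ->
    exists f, corner e f /\ idem f /\ forall y, rann_in e S y <-> rgen_in e f y.

Definition corner_graded_Baer (e : T) : Prop :=
  forall S : T -> Prop, (forall x, S x -> corner e x /\ homogeneous x) ->
    exists f, corner e f /\ idem f /\ homogeneous f /\
      forall y, rann_in e S y <-> rgen_in e f y.

Definition corner_graded_Baer_star (conj : K -> K) (p : T) : Prop :=
  forall S : T -> Prop, (forall x, S x -> corner p x /\ homogeneous x) ->
    exists f, corner p f /\ proj conj f /\ homogeneous f /\
      forall y, rann_in p S y <-> rgen_in p f y.

Definition locally_Baer : Prop := forall e, idem e -> corner_Baer e.
Definition graded_locally_Baer : Prop :=
  forall e, idem e -> homogeneous e -> corner_graded_Baer e.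
Definition graded_locally_Baer_star (conj : K -> K) : Prop :=
  forall p, proj conj p -> homogeneous p -> corner_graded_Baer_star conj p.

Definition unital : Prop := exists u, forall x, LMul u x ≈ x /\ LMul x u ≈ x.
Definition rann (S : T -> Prop) (y : T) : Prop := forall x, S x -> LMul x y ≈ L0.
Definition rgen (f y : T) : Prop := exists z, y ≈ LMul f z.

Definition Baer_ring : Prop :=
  unital /\ forall S : T -> Prop,
    exists f, idem f /\ forall y, rann S y <-> rgen f y.
Definition graded_Baer_ring : Prop :=
  unital /\ forall S : T -> Prop, (forall x, S x -> homogeneous x) ->
    exists f, idem f /\ homogeneous f /\ forall y, rann S y <-> rgen f y.
Definition graded_Baer_star_ring (conj : K -> K) : Prop :=
  forall S : T -> Prop, (forall x, S x -> homogeneous x) ->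
    exists f, proj conj f /\ homogeneous f /\ forall y, rann S y <-> rgen f y.
End Leavitt.

Definition field_involution (K : fieldType) (conj : K -> K) : Prop :=
  (forall a b, conj (a + b) = conj a + conj b)%R /\
  (forall a b, conj (a * b) = conj a * conj b)%R /\
  conj 1%R = 1%R /\ involutive conj.

Definition positive_definite (K : fieldType) (conj : K -> K) : Prop :=
  forall l : seq K, (\sum_(k <- l) k * conj k)%R = 0%R -> all (fun k => k == 0%R) l.

(* Main.v *)
(** If every path of [E] eventually reaches a terminal vertex (a vertex whose
    forward orbit is a single line, with either no return or a cycle), then
    each vertex is a finite sum of projections [p p^*] with [p] ending in a
    terminal vertex [t]. Annihilators are then computed row by row: for a
    nonzero row [x] in [t A e], the right ideal [x A t] of [t A t] (which is
    [K] or [K[z, 1/z]]) is principal, so [x = c w] and [x z = c] with [c]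
    cancellable, and [e - z w] generates the annihilator of [x] in [e A]. In
    the graded case one may take [c = t], and in the graded star case [z] a
    multiple of [x^*]. The process stops because the rank of [e] on the space
    of functions on boundary paths drops each time.

    Conversely, an infinite emitter, or an infinite path with infinitely many
    exits, yields paths [p_0, p_1, ...] from a vertex [v] with orthogonal
    projections [p_n p_n^*]. If [f] generates the annihilator of those with
    even [n], then the degree-zero coefficient of [p_n^* f p_n] is eventually
    constant, but it is [0] for even and [1] for odd [n]. *)

(* No basis of [L_K(E)] is constructed. Non-vanishing statements (vertices are nonzero, powers of a
   cycle are independent, degrees are unique) rest on one representation, on functions of a boundary
   path and an integer, in which an edge shifts the integer by [d]. With [d = 1] it sees the
   grading; with [d = 0] it yields the matrices whose rank measures an idempotent. These matrices
   are finite because an idempotent involves finitely many vertices, and a vertex whose pruned tree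
   of paths is finite starts only finitely many boundary paths.

   For necessity, all six ring conditions pass through one weak consequence, [weak_Baer]: only
   degree-zero subsets of the corner at a vertex are annihilated, and the generator may be any
   element of the algebra that kills the set and fixes its annihilator.

   For sufficiency in the graded cases, homogeneous idempotents are first shown to have degree zero,
   so that [e - z w] stays homogeneous along the descent. *)
Require Import Defs.
From HB Require Import structures.
From mathcomp Require Import all_boot all_order all_algebra.
From mathcomp Require Import boolp.
From mathcomp Require Import zify ring.
From Stdlib Require List.
Set Implicit Arguments. Unset Strict Implicit. Unset Printing Implicit Defensive.
Import GRing.Theory.
Local Open Scope ring_scope.

(** * The unitization of the Leavitt path algebra *)

HB.instance Definition _ (V Ed K : Type) := gen_eqMixin (lterm V Ed K).
HB.instance Definition _ (V Ed K : Type) := gen_choiceMixin (lterm V Ed K).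

Section Quotient.
Variables (V Ed : Type) (s r : Ed -> V) (K : fieldType).
Local Notation T := (lterm V Ed K).
Local Notation "x ≈ y" := (Defs.leq s r x y) (at level 70).

Definition leqb (x y : T) : bool := `[< x ≈ y >].

Lemma leqb_refl : reflexive leqb.
Proof. by move=> x; apply/asboolP; apply: Defs.leq_refl. Qed.
Lemma leqb_sym : symmetric leqb.
Proof. by move=> x y; apply/asboolP/asboolP; apply: leq_sym. Qed.
Lemma leqb_trans : transitive leqb.
Proof. by move=> y x z /asboolP xy /asboolP yz; apply/asboolP; apply: Defs.leq_trans xy yz. Qed.

Definition leqb_equiv := EquivRel leqb leqb_refl leqb_sym leqb_trans.

Definition lpa := {eq_quot leqb_equiv}%qT.
HB.instance Definition _ := Choice.on lpa.

Definition lcl (x : T) : lpa := \pi_({eq_quot leqb_equiv})%qT x.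
Definition lrep (q : lpa) : T := repr (q : {eq_quot leqb_equiv}%qT).

Lemma lclP x y : lcl x = lcl y <-> x ≈ y.
Proof. by split=> [/eqmodP /asboolP|h]//; apply/eqmodP/asboolP. Qed.
Lemma lrepK q : lcl (lrep q) = q.
Proof. exact: reprK. Qed.
Lemma lclK x : lrep (lcl x) ≈ x.
Proof. by apply/lclP; rewrite lrepK. Qed.

Definition ladd (p q : lpa) := lcl (LAdd (lrep p) (lrep q)).
Definition lscal (k : K) (q : lpa) := lcl (LScal k (lrep q)).
Definition lmul (p q : lpa) := lcl (LMul (lrep p) (lrep q)).

Lemma ladd_cl x y : ladd (lcl x) (lcl y) = lcl (LAdd x y).
Proof. by apply/lclP; apply: Defs.leq_add; apply: lclK. Qed.
Lemma lscal_cl k x : lscal k (lcl x) = lcl (LScal k x).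
Proof. by apply/lclP; apply: leq_scal; apply: lclK. Qed.
Lemma lmul_cl x y : lmul (lcl x) (lcl y) = lcl (LMul x y).
Proof. by apply/lclP; apply: Defs.leq_mul; apply: lclK. Qed.

Local Opaque lcl ladd lscal lmul.

Lemma lpa_ind (P : lpa -> Prop) : (forall x, P (lcl x)) -> forall q, P q.
Proof. by move=> h q; rewrite -(lrepK q). Qed.

Lemma laddA : associative ladd.
Proof.
elim/lpa_ind=> x; elim/lpa_ind=> y; elim/lpa_ind=> z.
by rewrite !ladd_cl; apply/lclP; apply: leq_addA.
Qed.
Lemma laddC : commutative ladd.
Proof.
by elim/lpa_ind=> x; elim/lpa_ind=> y; rewrite !ladd_cl; apply/lclP; apply: leq_addC.
Qed.
Lemma ladd0 : left_id (lcl L0) ladd.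
Proof. by elim/lpa_ind=> x; rewrite ladd_cl; apply/lclP; apply: leq_add0. Qed.
Lemma laddN : left_inverse (lcl L0) (lscal (-1)) ladd.
Proof.
by elim/lpa_ind=> x; rewrite laddC lscal_cl ladd_cl; apply/lclP; apply: leq_addN.
Qed.
HB.instance Definition _ := GRing.isZmodule.Build lpa laddA laddC ladd0 laddN.

Lemma lclD x y : lcl (LAdd x y) = lcl x + lcl y.
Proof. by rewrite -ladd_cl. Qed.

Lemma lscalA a b (x : lpa) : lscal a (lscal b x) = lscal (a * b) x.
Proof.
by elim/lpa_ind: x => x; rewrite !lscal_cl; apply/lclP/leq_sym; apply: leq_scalA.
Qed.
Lemma lscal1 : left_id 1 lscal.
Proof. by elim/lpa_ind=> x; rewrite lscal_cl; apply/lclP; apply: leq_scal1. Qed.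
Lemma lscalDr : right_distributive lscal +%R.
Proof.
move=> a; elim/lpa_ind=> x; elim/lpa_ind=> y.
by rewrite -(lclD x) !lscal_cl -lclD; apply/lclP; apply: leq_scalDr.
Qed.
Lemma lscalDl (q : lpa) : {morph lscal^~ q : a b / a + b}.
Proof.
elim/lpa_ind: q => x a b /=.
by rewrite !lscal_cl -!lclD; apply/lclP; apply: leq_scalDl.
Qed.
HB.instance Definition _ := GRing.Zmodule_isLmodule.Build K lpa lscalA lscal1 lscalDr lscalDl.

Lemma lclZ k x : lcl (LScal k x) = k *: lcl x.
Proof. by rewrite -lscal_cl. Qed.

Lemma lmulA : associative lmul.
Proof.
elim/lpa_ind=> x; elim/lpa_ind=> y; elim/lpa_ind=> z.
by rewrite !lmul_cl; apply/lclP; apply: leq_mulA.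
Qed.
Lemma lmulDl : left_distributive lmul +%R.
Proof.
elim/lpa_ind=> x; elim/lpa_ind=> y; elim/lpa_ind=> z.
by rewrite -(lclD x) !lmul_cl -lclD; apply/lclP; apply: leq_mulDl.
Qed.
Lemma lmulDr : right_distributive lmul +%R.
Proof.
elim/lpa_ind=> x; elim/lpa_ind=> y; elim/lpa_ind=> z.
by rewrite -(lclD y) !lmul_cl -lclD; apply/lclP; apply: leq_mulDr.
Qed.
Lemma lmulZl k x y : lmul (k *: x) y = k *: lmul x y.
Proof.
elim/lpa_ind: x => x; elim/lpa_ind: y => y.
by rewrite -(lclZ k x) !lmul_cl -lclZ; apply/lclP; apply: leq_scalMl.
Qed.
Lemma lmulZr k x y : lmul x (k *: y) = k *: lmul x y.
Proof.
elim/lpa_ind: x => x; elim/lpa_ind: y => y.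
by rewrite -(lclZ k y) !lmul_cl -lclZ; apply/lclP; apply: leq_scalMr.
Qed.

(* The unitization [K * L_K(E)], so that all computations take place in a
   unital [K]-algebra. *)
Definition ulpa : Type := (K^o * lpa)%type.
HB.instance Definition _ := GRing.Lmodule.copy ulpa (K^o * lpa)%type.

Definition uone : ulpa := (1, 0).
Definition umul (x y : ulpa) : ulpa :=
  (x.1 * y.1, x.1 *: y.2 + y.1 *: x.2 + lmul x.2 y.2).

Lemma lmul0l x : lmul 0 x = 0.
Proof. by have := lmulZl 0 0 x; rewrite !scale0r. Qed.
Lemma lmul0r x : lmul x 0 = 0.
Proof. by have := lmulZr 0 x 0; rewrite !scale0r. Qed.

Lemma umulA : associative umul.
Proof.
move=> [a x] [b y] [c z]; rewrite /umul /=; congr pair; first by rewrite mulrA.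
rewrite !(lmulDl, lmulDr, lmulZl, lmulZr, scalerDr, scalerA) lmulA.
rewrite [c * b]mulrC [c * a]mulrC -!addrA; congr (_ + _).
congr (_ + _); rewrite addrCA; congr (_ + _).
by rewrite addrCA [RHS]addrCA; congr (_ + _); rewrite addrCA.
Qed.
Lemma umul1l : left_id uone umul.
Proof. by move=> [a x]; rewrite /umul /= mul1r scale1r scaler0 lmul0l !addr0. Qed.
Lemma umul1r : right_id uone umul.
Proof. by move=> [a x]; rewrite /umul /= mulr1 scale1r scaler0 lmul0r add0r addr0. Qed.
Lemma umulDl : left_distributive umul +%R.
Proof.
move=> [a x] [b y] [c z]; rewrite /umul /=; congr pair; first by rewrite mulrDl.
by rewrite lmulDl scalerDl scalerDr [X in X + _]addrACA /= [LHS]addrACA.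
Qed.
Lemma umulDr : right_distributive umul +%R.
Proof.
move=> [a x] [b y] [c z]; rewrite /umul /=; congr pair; first by rewrite mulrDr.
by rewrite lmulDr scalerDl scalerDr [X in X + _]addrACA /= [LHS]addrACA.
Qed.
Lemma uone_neq0 : uone != 0.
Proof. by apply/eqP=> -[/eqP]; rewrite oner_eq0. Qed.
HB.instance Definition _ :=
  GRing.Zmodule_isNzRing.Build ulpa umulA umul1l umul1r umulDl umulDr uone_neq0.

Lemma uscalAl (k : K) (x y : ulpa) : k *: (x * y) = k *: x * y.
Proof.
case: x y => [a x] [b y]; congr pair => /=; first by rewrite scalerAl.
by rewrite !scalerDr lmulZl !scalerA [k * b]mulrC.
Qed.
HB.instance Definition _ := GRing.Lmodule_isLalgebra.Build K ulpa uscalAl.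
Lemma uscalAr (k : K) (x y : ulpa) : k *: (x * y) = x * (k *: y).
Proof.
case: x y => [a x] [b y]; congr pair => /=; first by rewrite scalerAr.
by rewrite !scalerDr lmulZr !scalerA [k * a]mulrC.
Qed.
HB.instance Definition _ := GRing.Lalgebra_isAlgebra.Build K ulpa uscalAr.

Definition inj (x : T) : ulpa := (0, lcl x).

Lemma injP x y : inj x = inj y <-> x ≈ y.
Proof. by rewrite -lclP /inj; split=> [[]|->]. Qed.
Lemma injD x y : inj (LAdd x y) = inj x + inj y.
Proof. by rewrite /inj lclD; congr pair; rewrite /= addr0. Qed.
Lemma injZ k x : inj (LScal k x) = k *: inj x.
Proof. by rewrite /inj lclZ; congr pair; rewrite /= scaler0. Qed.
Lemma injM x y : inj (LMul x y) = inj x * inj y.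
Proof.
rewrite /inj -lmul_cl; congr pair; rewrite /=; first by rewrite mulr0.
by rewrite !scale0r !add0r.
Qed.
Lemma inj0 : inj L0 = 0. Proof. by []. Qed.

Definition uv v : ulpa := inj (LV v).
Definition ue e : ulpa := inj (LE e).
Definition us e : ulpa := inj (LS e).

Lemma uvv v : uv v * uv v = uv v.
Proof. by rewrite -injM; apply/injP; constructor. Qed.
Lemma uvw v w : v <> w -> uv v * uv w = 0.
Proof. by move=> h; rewrite -injM -inj0; apply/injP; constructor. Qed.
Lemma use e : uv (s e) * ue e = ue e.
Proof. by rewrite -injM; apply/injP; constructor. Qed.
Lemma uer e : ue e * uv (r e) = ue e.
Proof. by rewrite -injM; apply/injP; constructor. Qed.
Lemma urs e : uv (r e) * us e = us e.
Proof. by rewrite -injM; apply/injP; constructor. Qed.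
Lemma uss e : us e * uv (s e) = us e.
Proof. by rewrite -injM; apply/injP; constructor. Qed.
Lemma uck1 e : us e * ue e = uv (r e).
Proof. by rewrite -injM; apply/injP; constructor. Qed.
Lemma uck1' e f : e <> f -> us e * ue f = 0.
Proof. by move=> h; rewrite -injM -inj0; apply/injP; constructor. Qed.
Lemma uck2 v (l : list Ed) : l <> nil -> List.NoDup l ->
  (forall e, s e = v <-> List.In e l) -> uv v = \sum_(e <- l) ue e * us e.
Proof.
move=> h1 h2 h3; have /injP := leq_ck2 r K h1 h2 h3; rewrite -/(uv v) => ->.
elim: l {h1 h2 h3} => [|e l IH]; first by rewrite big_nil.
by rewrite big_cons -IH /= injD injM.
Qed.

(** The path algebra is the kernel of the projection of its unitization to [K], a two-sided ideal;
    this is why one factor suffices in [memMl] and [memMr]. *)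
Definition mem_lpa (x : ulpa) := x.1 = 0.

Lemma mem_inj x : mem_lpa (inj x). Proof. by []. Qed.
Lemma memP x : mem_lpa x -> {t | x = inj t}.
Proof. by case: x => a q /= ha; exists (lrep q); rewrite /inj lrepK -ha. Qed.
Lemma memMl x y : mem_lpa x -> mem_lpa (x * y).
Proof. by rewrite /mem_lpa /= => ->; rewrite mul0r. Qed.
Lemma memMr x y : mem_lpa y -> mem_lpa (x * y).
Proof. by rewrite /mem_lpa /= => ->; rewrite mulr0. Qed.
Lemma memD x y : mem_lpa x -> mem_lpa y -> mem_lpa (x + y).
Proof. by rewrite /mem_lpa /= => -> ->; rewrite addr0. Qed.
Lemma memZ k x : mem_lpa x -> mem_lpa (k *: x).
Proof. by rewrite /mem_lpa /= => ->; rewrite scaler0. Qed.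
End Quotient.

(** * Walks and monomials *)

Section Walks.
Variables (V Ed : Type) (s r : Ed -> V).

(** Both endpoints are recorded, unlike in [epath], so that the empty path has a vertex. *)
Fixpoint walk (v : V) (p : seq Ed) (w : V) : Prop :=
  if p is e :: q then s e = v /\ walk (r e) q w else v = w.

Lemma walk_cat v p q w : walk v (p ++ q) w <-> exists2 u, walk v p u & walk u q w.
Proof.
elim: p v => [|e p IH] v /=; first by split=> [h|[u -> //]]; exists v.
split=> [[-> /IH[u h1 h2]]|[u [-> h1] h2]]; first by exists u.
by split=> //; apply/IH; exists u.
Qed.

Lemma walk_inj v p w w' : walk v p w -> walk v p w' -> w = w'.
Proof.
elim: p v => [|e p IH] v /=; first by move=> <-.
by move=> [_ h1] [_ h2]; apply: IH h1 h2.
Qed.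

Lemma walk_rcons v p e w : walk v (rcons p e) w <-> walk v p (s e) /\ w = r e.
Proof.
rewrite -cats1; split=> [/walk_cat[u h /= [-> ->]]//|[h ->]].
by apply/walk_cat; exists (s e).
Qed.
End Walks.

Section Monomials.
Variables (V Ed : Type) (s r : Ed -> V) (K : fieldType).
Local Notation U := (ulpa s r K).
Local Notation uv := (uv s r K).
Local Notation ue := (ue s r K).
Local Notation us := (us s r K).
Local Notation walk := (walk s r).
Implicit Types (x y : U) (v w : V) (p q : seq Ed).

Definition pth p : U := \prod_(e <- p) ue e.
Definition gst p : U := \prod_(e <- rev p) us e.

Lemma pth_nil : pth [::] = 1. Proof. by rewrite /pth big_nil. Qed.
Lemma gst_nil : gst [::] = 1. Proof. by rewrite /gst big_nil. Qed.
Lemma pth_cons e p : pth (e :: p) = ue e * pth p.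
Proof. by rewrite /pth big_cons. Qed.
Lemma gst_cons e p : gst (e :: p) = gst p * us e.
Proof. by rewrite /gst rev_cons -cats1 big_cat big_seq1. Qed.
Lemma pth_cat p q : pth (p ++ q) = pth p * pth q.
Proof. by rewrite /pth big_cat. Qed.
Lemma gst_cat p q : gst (p ++ q) = gst q * gst p.
Proof. by rewrite /gst rev_cat big_cat. Qed.

Lemma uv_pth v p w : walk v p w -> uv v * pth p = pth p * uv w.
Proof.
elim: p v => [|e p IH] v /=; first by move=> ->; rewrite pth_nil mulr1 mul1r.
by move=> [<- /IH h]; rewrite pth_cons mulrA use -mulrA -h mulrA uer.
Qed.
Lemma uv_gst v p w : walk v p w -> uv w * gst p = gst p * uv v.
Proof.
elim: p v => [|e p IH] v /=; first by move=> ->; rewrite gst_nil mulr1 mul1r.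
by move=> [<- /IH h]; rewrite gst_cons mulrA h -!mulrA urs uss.
Qed.
Lemma gst_pth v p w : walk v p w -> gst p * pth p * uv w = uv w.
Proof.
elim: p v => [|e p IH] v /=; first by rewrite gst_nil pth_nil !mul1r.
move=> [_ h]; rewrite gst_cons pth_cons mulrA -[gst p * us e * _]mulrA uck1.
by rewrite -(mulrA (gst p)) (uv_pth h) -!mulrA uvv mulrA (IH _ h).
Qed.
Lemma gst_pth' v p w : walk v p w -> uv w * gst p * pth p = uv w.
Proof. by move=> h; rewrite (uv_gst h) -mulrA (uv_pth h) mulrA (gst_pth h). Qed.

(** Common first edges cancel by [uck1], and the first disagreement gives zero by [uck1']. What
    survives is the case in which one path runs out first. *)
Lemma gst_pth_cases v p w v' q w' : walk v p w -> walk v' q w' ->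
  (exists t, q = p ++ t) \/ (exists t, p = q ++ t) \/
  uv w * gst p * pth q * uv w' = 0.
Proof.
elim: p q v v' => [|e p IH] q v v' /=; first by move=> *; left; exists q.
case: q => [|f q] /=; first by move=> *; right; left; exists (e :: p).
move=> [_ h1] [_ h2]; have [eqef|nef] := pselect (e = f); last first.
  right; right; rewrite gst_cons pth_cons -!mulrA (mulrA (us e)) uck1' //.
  by rewrite !(mul0r, mulr0).
subst f; have [[t ->]|[[t ->]|h]] := IH _ _ _ h1 h2; first by left; exists t.
  by right; left; exists t.
right; right; rewrite gst_cons pth_cons -!mulrA (mulrA (us e)) uck1.
by rewrite (mulrA (uv (r e))) (uv_pth h2) -mulrA uvv !mulrA.
Qed.

(** The vertex in the middle is essential: for empty [p] and [q] the outer factors are the [1] of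
    the unitization. *)
Definition mon p w q : U := pth p * uv w * gst q.

Inductive spn (C : seq Ed -> V -> seq Ed -> Prop) : U -> Prop :=
  | spn0 : spn C 0
  | spnS k p w q x : C p w q -> spn C x -> spn C (k *: mon p w q + x).

Lemma spn_sub (C C' : seq Ed -> V -> seq Ed -> Prop) x :
  (forall p w q, C p w q -> C' p w q) -> spn C x -> spn C' x.
Proof. by move=> h; elim=> [|k p w q y c _ IH]; constructor=> //; apply: h. Qed.
Lemma spnD C x y : spn C x -> spn C y -> spn C (x + y).
Proof.
by move=> hx hy; elim: hx => [|k p w q z c _ IH]; rewrite ?add0r -?addrA //; constructor.
Qed.
Lemma spnZ C k x : spn C x -> spn C (k *: x).
Proof.
elim=> [|l p w q z c _ IH]; first by rewrite scaler0; constructor.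
by rewrite scalerDr scalerA; constructor.
Qed.
Lemma spnN C x : spn C x -> spn C (- x).
Proof. by rewrite -scaleN1r; apply: spnZ. Qed.
Lemma spnB C x y : spn C x -> spn C y -> spn C (x - y).
Proof. by move=> hx hy; apply: spnD => //; apply: spnN. Qed.
Lemma spn_mon C p w q : C p w q -> spn C (mon p w q).
Proof.
by move=> c; rewrite -[mon _ _ _]addr0 -[mon _ _ _]scale1r; apply: spnS => //; constructor.
Qed.
Lemma spn_sum C (I : Type) (l : seq I) (F : I -> U) :
  (forall i, spn C (F i)) -> spn C (\sum_(i <- l) F i).
Proof.
move=> h; elim: l => [|i l IH]; rewrite ?big_nil ?big_cons; first by constructor.
exact: spnD.
Qed.

Definition mdeg p q : int := (size p)%:Z - (size q)%:Z.
Definition Mon (D : int -> Prop) p w q :=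
  [/\ exists v, walk v p w, exists v, walk v q w & D (mdeg p q)].
Definition CMon (D : int -> Prop) v v' p w q :=
  [/\ walk v p w, walk v' q w & D (mdeg p q)].
Definition anydeg (n : int) := True.

(* [spn (Mon anydeg)] is the path algebra itself, [spn (Mon (eq n))] its
   homogeneous component of degree [n]. *)

Lemma mon_mul v1 p w q v2 v3 p' w' q' v4 :
  walk v1 p w -> walk v2 q w -> walk v3 p' w' -> walk v4 q' w' ->
  mon p w q * mon p' w' q' = 0 \/
  exists P W Q, [/\ mon p w q * mon p' w' q' = mon P W Q, walk v1 P W, walk v4 Q W &
    mdeg P Q = mdeg p q + mdeg p' q'].
Proof.
move=> h1 h2 h3 h4.
have e0 : mon p w q * mon p' w' q' = pth p * (uv w * gst q * pth p' * uv w') * gst q'.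
  by rewrite /mon !mulrA.
have [[t et]|[[t et]|z]] := gst_pth_cases h2 h3; last by left; rewrite e0 z mulr0 mul0r.
  subst p'; move: h3 => /walk_cat[w2 h31 h32].
  have e1 : uv w * gst q * pth (q ++ t) * uv w' = uv w * uv w2 * pth t * uv w'.
    have e2 z : gst q * (pth q * (uv w2 * z)) = uv w2 * z.
      by rewrite !mulrA (gst_pth h31).
    by rewrite pth_cat -!mulrA -(uv_pth h32) e2 (mulrA (uv w2)) uvv.
  have [ww|nww] := pselect (w = w2); last first.
    by left; rewrite e0 e1 (uvw _ _ _ nww) !(mul0r, mulr0).
  right; exists (p ++ t), w', q'; subst w2; rewrite e0 e1 uvv; split=> //.
  - by rewrite (uv_pth h32) /mon pth_cat -!mulrA (mulrA (uv w')) uvv.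
  - by apply/walk_cat; exists w.
  - by rewrite /mdeg !size_cat; lia.
subst q; move: h2 => /walk_cat[w2 h21 h22].
have e2 : uv w * gst t = uv w * gst t * uv w2 by rewrite (uv_gst h22) -mulrA uvv.
have e1 : uv w * gst (p' ++ t) * pth p' * uv w' = uv w * gst t * uv w2 * uv w'.
  by rewrite gst_cat !mulrA e2 -[in RHS](mulrA _ (uv w2) (uv w2)) uvv -[in RHS](gst_pth' h21) !mulrA.
have [ww|nww] := pselect (w' = w2); last first.
  left; rewrite e0 e1 -(mulrA (uv w * gst t)) (@uvw _ _ _ _ _ w2 w') ?mulr0 ?mul0r //.
  by move=> ?; apply: nww.
subst w2; right; exists p, w, (q' ++ t); rewrite e0 e1; split=> //.
- by rewrite -(mulrA (uv w * gst t)) uvv -e2 /mon gst_cat !mulrA.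
- by apply/walk_cat; exists w'.
- by rewrite /mdeg !size_cat; lia.
Qed.

(** Degrees enter as predicates so that exact, arbitrary, shifted and negated degrees are all
    covered. *)
Lemma spn_mul (D D' D'' : int -> Prop) x y :
  (forall a b, D a -> D' b -> D'' (a + b)) ->
  spn (Mon D) x -> spn (Mon D') y -> spn (Mon D'') (x * y).
Proof.
move=> hD hx hy; elim: hx => [|k p w q z [[v1 h1] [v2 h2] dd] _ IH].
  by rewrite mul0r; constructor.
rewrite mulrDl -scalerAl; apply: spnD => //; apply: spnZ.
elim: hy {IH} => [|k' p' w' q' z' [[v3 h3] [v4 h4] dd'] _ IH'].
  by rewrite mulr0; constructor.
rewrite mulrDr -scalerAr; apply: spnD => //; apply: spnZ.
have [->|[P [W [Q [-> a b c]]]]] := mon_mul h1 h2 h3 h4; first by constructor.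
by apply: spn_mon; split; [exists v1|exists v4|rewrite c; apply: hD].
Qed.

Lemma mon_uv v : mon [::] v [::] = uv v.
Proof. by rewrite /mon pth_nil gst_nil mulr1 mul1r. Qed.
Lemma mon_ue e : mon [:: e] (r e) [::] = ue e.
Proof. by rewrite /mon pth_cons pth_nil gst_nil !mulr1 uer. Qed.
Lemma mon_us e : mon [::] (r e) [:: e] = us e.
Proof. by rewrite /mon gst_cons pth_nil gst_nil !mul1r urs. Qed.

Lemma spn_uv (D : int -> Prop) v : D 0 -> spn (Mon D) (uv v).
Proof. by move=> d; rewrite -mon_uv; apply: spn_mon; split=> //; exists v. Qed.

Lemma spn_hom n (x : lterm V Ed K) : Defs.hom s r n x -> spn (Mon (eq n)) (inj s r x).
Proof.
elim=> {n x}.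
- by move=> v; apply: spn_uv.
- move=> e; rewrite -[inj _ _ _]/(ue e) -mon_ue; apply: spn_mon; split; last exact: erefl.
    by exists (s e).
  by exists (r e).
- move=> e; rewrite -[inj _ _ _]/(us e) -mon_us; apply: spn_mon; split; last exact: erefl.
    by exists (r e).
  by exists (s e).
- by move=> n; rewrite inj0; constructor.
- by move=> n x y _ hx _ hy; rewrite injD; apply: spnD.
- by move=> n k x _ hx; rewrite injZ; apply: spnZ.
- by move=> m n x y _ hx _ hy; rewrite injM; apply: spn_mul hx hy => a b <- <-.
- by move=> n x y _ hx /injP <-.
Qed.

Lemma spn_inj (x : lterm V Ed K) : spn (Mon anydeg) (inj s r x).
Proof.
have sub n (y : lterm V Ed K) : Defs.hom s r n y -> spn (Mon anydeg) (inj s r y).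
  by move/spn_hom; apply: spn_sub => p w q [].
elim: x => [v|e|e||x IHx y IHy|k x IHx|x IHx y IHy].
- exact: sub (hom_V _ _ _ _).
- exact: sub (hom_E _ _ _ _).
- exact: sub (hom_S _ _ _ _).
- by rewrite inj0; constructor.
- by rewrite injD; apply: spnD.
- by rewrite injZ; apply: spnZ.
- by rewrite injM; apply: spn_mul IHx IHy.
Qed.

Lemma hom_spn n x : spn (Mon (eq n)) x -> exists2 t, Defs.hom s r n t & x = inj s r t.
Proof.
elim=> [|k p w q z [_ _ d] _ [t ht ->]]; first by exists L0; [constructor|].
suff [m hm ->] : exists2 m, Defs.hom s r n m & mon p w q = inj s r m.
  by exists (LAdd (LScal k m) t); [by apply: hom_add => //; apply: hom_scal|rewrite injD injZ].
have [a ha ea] : exists2 a, Defs.hom s r (size p)%:Z a & pth p * uv w = inj s r a.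
  elim: p {d} => [|e p [a ha ea]]; first by exists (LV w); [constructor|rewrite pth_nil mul1r].
  exists (LMul (LE e) a); last by rewrite injM pth_cons -mulrA ea.
  by rewrite -[size _]/(1 + size p)%N PoszD; constructor=> //; constructor.
rewrite /mon ea d /mdeg.
elim/last_ind: q p a ha {ea d} => [|q e IH] p a ha.
  by exists a; rewrite ?gst_nil ?mulr1 //= subr0.
suff: exists2 m, Defs.hom s r ((size p)%:Z - 1 - (size q)%:Z) m & inj s r a * us e * gst q = inj s r m.
  move=> [m hm em]; exists m; last by rewrite -em -cats1 gst_cat gst_cons gst_nil mul1r mulrA.
  by rewrite size_rcons -addn1 PoszD; move: hm; congr Defs.hom; lia.
have {ha} : Defs.hom s r ((size p)%:Z - 1) (LMul a (LS e)) by constructor=> //; constructor.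
have -> : inj s r a * us e = inj s r (LMul a (LS e)) by rewrite injM.
(* The left factor and its degree are generalised, and the outer hypothesis dropped, so that the
   inner induction can absorb the ghost edges one at a time into the left factor. *)
move: (LMul a (LS e)) ((size p)%:Z - 1) => {IH}.
elim/last_ind: q => [|q f IH] b m hb.
  by exists b; rewrite ?gst_nil ?mulr1 //= subr0.
have hb' : Defs.hom s r (m - 1) (LMul b (LS f)) by constructor=> //; constructor.
have [c hc ec] := IH _ _ hb'; exists c; last first.
  by rewrite -ec -cats1 gst_cat gst_cons gst_nil mul1r injM mulrA.
by move: hc; rewrite size_rcons -addn1 PoszD; congr Defs.hom; lia.
Qed.

Lemma mem_spn x : spn (Mon anydeg) x -> mem_lpa x.
Proof.
elim=> [//|k p w q z _ _ h]; apply: memD => //; apply: memZ.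
by apply: memMl; apply: memMr.
Qed.

Lemma spn_any D x : spn (Mon D) x -> spn (Mon anydeg) x.
Proof. by apply: spn_sub => p w q []. Qed.

Lemma uv_mon_l v v' p w q : walk v' p w ->
  (v = v' /\ uv v * mon p w q = mon p w q) \/ (v <> v' /\ uv v * mon p w q = 0).
Proof.
move=> h; have [e|n] := pselect (v = v').
  by left; split=> //; rewrite e /mon !mulrA (uv_pth h) -(mulrA _ _ (uv w)) uvv.
by right; split=> //; rewrite /mon -(uv_pth h) !mulrA (uvw _ _ _ n) !mul0r.
Qed.
Lemma uv_mon_r v v' p w q : walk v' q w ->
  (v = v' /\ mon p w q * uv v = mon p w q) \/ (v <> v' /\ mon p w q * uv v = 0).
Proof.
move=> h; have [e|n] := pselect (v = v').
  by left; split=> //; rewrite e /mon -!mulrA -(uv_gst h) (mulrA (uv w)) uvv.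
right; split=> //; rewrite /mon -!mulrA (mulrA (uv w)) (uv_gst h) -!mulrA.
by rewrite (@uvw _ _ _ _ _ v' v) ?mulr0 // => ?; apply: n.
Qed.

Lemma spn_corner D v v' x :
  spn (Mon D) x -> spn (CMon D v v') (uv v * x * uv v').
Proof.
elim=> [|k p w q z [[a ha] [b hb] d] _ IH]; first by rewrite mulr0 mul0r; constructor.
rewrite mulrDr mulrDl; apply: spnD => //.
rewrite -scalerAr -scalerAl; apply: spnZ.
have [[ea ->]|[_ ->]] := uv_mon_l v q ha; last by rewrite mul0r; constructor.
have [[eb ->]|[_ ->]] := uv_mon_r v' p hb; last by constructor.
by apply: spn_mon; subst; split.
Qed.
End Monomials.

(** * Involution and local units *)

Section Star.
Variables (V Ed : Type) (s r : Ed -> V) (K : fieldType) (conj : K -> K).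
Hypothesis conjP : field_involution conj.
Local Notation U := (ulpa s r K).
Local Notation uv := (uv s r K).
Local Notation ue := (ue s r K).
Local Notation us := (us s r K).
Local Notation "x ≈ y" := (Defs.leq s r x y) (at level 70).
Local Notation star := (lstar conj).

Lemma conjD a b : conj (a + b) = conj a + conj b. Proof. by case: conjP. Qed.
Lemma conjM a b : conj (a * b) = conj a * conj b. Proof. by case: conjP => _ []. Qed.
Lemma conj1 : conj 1 = 1. Proof. by case: conjP => _ [_ []]. Qed.
Lemma conjK : involutive conj. Proof. by case: conjP => _ [_ []]. Qed.
Lemma conj0 : conj 0 = 0.
Proof. by apply: (@addrI _ (conj 0)); rewrite -conjD !addr0. Qed.
Lemma conjN1 : conj (-1) = -1.
Proof. by apply: (@addrI _ 1); rewrite -{1}conj1 -conjD !subrr conj0. Qed.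

(** Star permutes the defining relations: [leq_se] with [leq_ss], [leq_er] with [leq_rs]. The sum in
    [leq_ck2] is fixed literally, each [e e^*] being self-adjoint. *)
Lemma lstar_leq x y : x ≈ y -> star x ≈ star y.
Proof.
elim=> {x y} /=; rewrite ?conjN1 ?conj1; try by [constructor | move=> *; constructor].
- by move=> x y z _ h1 _ h2; apply: Defs.leq_trans h1 h2.
- by move=> k l x; rewrite conjD; constructor.
- by move=> k l x; rewrite conjM; constructor.
- by move=> x y z; apply: Defs.leq_sym; constructor.
- by move=> v w h; constructor=> ?; apply: h.
- by move=> e f h; constructor=> ?; apply: h.
move=> v l h1 h2 h3.
set g := fun e => LMul (LE e) (LS e).
suff -> : star (lsum (List.map g l)) = lsum (List.map g l) by constructor.
by elim: l {h1 h2 h3} => //= e l ->.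
Qed.

Lemma lstarK (x : lterm V Ed K) : star (star x) = x.
Proof. by elim: x => //= [x -> y ->|k x ->|x -> y ->] //; rewrite conjK. Qed.

Definition qstar (q : lpa s r K) : lpa s r K := lcl s r (star (lrep q)).
Definition ustar (x : U) : U := (conj x.1, qstar x.2).

Lemma qstar_cl x : qstar (lcl s r x) = lcl s r (star x).
Proof. by apply/lclP/lstar_leq/lclK. Qed.

Lemma ustar_inj x : ustar (inj s r x) = inj s r (star x).
Proof. by rewrite /ustar /inj qstar_cl /= conj0. Qed.

Lemma qstarD x y : qstar (x + y) = qstar x + qstar y.
Proof.
by elim/lpa_ind: x => x; elim/lpa_ind: y => y; rewrite -lclD !qstar_cl /= lclD.
Qed.
Lemma qstarZ k x : qstar (k *: x) = conj k *: qstar x.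
Proof. by elim/lpa_ind: x => x; rewrite -lclZ !qstar_cl /= lclZ. Qed.
Lemma qstarM x y : qstar (lmul x y) = lmul (qstar y) (qstar x).
Proof.
elim/lpa_ind: x => x; elim/lpa_ind: y => y.
by rewrite lmul_cl !qstar_cl lmul_cl.
Qed.

Lemma ustarD x y : ustar (x + y) = ustar x + ustar y.
Proof. by rewrite /ustar conjD qstarD. Qed.
Lemma ustarZ k x : ustar (k *: x) = conj k *: ustar x.
Proof. by rewrite /ustar qstarZ conjM. Qed.
Lemma ustarM x y : ustar (x * y) = ustar y * ustar x.
Proof.
rewrite /ustar /= !qstarD !qstarZ qstarM conjM mulrC.
by congr pair; rewrite /=; congr (_ + _); rewrite addrC.
Qed.
Lemma ustarK x : ustar (ustar x) = x.
Proof.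
case: x => a q; rewrite /ustar /= conjK; congr pair.
by elim/lpa_ind: q => x; rewrite !qstar_cl lstarK.
Qed.
Lemma ustar0 : ustar 0 = 0.
Proof. by rewrite -(inj0 s r K) ustar_inj. Qed.
Lemma ustar1 : ustar 1 = 1.
Proof. by rewrite -[LHS]mulr1 -{2}(ustarK 1) -ustarM mulr1 ustarK. Qed.
Lemma ustarN x : ustar (- x) = - ustar x.
Proof. by rewrite -!scaleN1r ustarZ conjN1. Qed.
Lemma ustarB x y : ustar (x - y) = ustar x - ustar y.
Proof. by rewrite ustarD ustarN. Qed.
Lemma ustar_sum (I : Type) (l : seq I) (F : I -> U) :
  ustar (\sum_(i <- l) F i) = \sum_(i <- l) ustar (F i).
Proof.
by elim: l => [|i l IH]; rewrite ?big_nil ?big_cons ?ustar0 // ustarD IH.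
Qed.
Lemma ustar_uv v : ustar (uv v) = uv v. Proof. by rewrite ustar_inj. Qed.
Lemma ustar_ue e : ustar (ue e) = us e. Proof. by rewrite ustar_inj. Qed.
Lemma ustar_pth p : ustar (pth s r K p) = gst s r K p.
Proof.
elim: p => [|e p IH]; first by rewrite pth_nil gst_nil ustar1.
by rewrite pth_cons gst_cons ustarM ustar_ue IH.
Qed.
Lemma ustar_gst p : ustar (gst s r K p) = pth s r K p.
Proof. by rewrite -ustar_pth ustarK. Qed.
Lemma ustar_mon p w q : ustar (mon s r K p w q) = mon s r K q w p.
Proof. by rewrite /mon !ustarM ustar_pth ustar_gst ustar_uv mulrA. Qed.

Lemma spn_star n x : spn (Mon s r (eq n)) x -> spn (Mon s r (eq (- n))) (ustar x).
Proof.
elim=> [|k p w q z [h1 h2 d] _ IH]; first by rewrite ustar0; constructor.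
rewrite ustarD ustarZ; apply: spnD => //; apply: spnZ; rewrite ustar_mon.
by apply: spn_mon; split=> //; rewrite d /mdeg opprB.
Qed.
End Star.

Section LocalUnits.
Variables (V : choiceType) (Ed : Type) (s r : Ed -> V) (K : fieldType).
Local Notation U := (ulpa s r K).
Local Notation uv := (uv s r K).

Definition vsum (F : seq V) : U := \sum_(v <- F) uv v.

Lemma vsum_uv F v : uniq F -> v \in F -> vsum F * uv v = uv v /\ uv v * vsum F = uv v.
Proof.
rewrite /vsum => uF vF; rewrite mulr_suml mulr_sumr !(big_rem v vF) /= !uvv.
rewrite !big1_seq ?addr0 // => w /andP[_]; rewrite mem_rem_uniq // => /andP[/eqP nw _];
  apply: uvw => //; by move=> ?; apply: nw.
Qed.

(** [F0] collects the end vertices of the monomials of [x]. Allowing every larger [F] lets two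
    elements share one unit. *)
Lemma local_unit x : mem_lpa x -> exists F0 : seq V, forall F, uniq F ->
  {subset F0 <= F} -> vsum F * x = x /\ x * vsum F = x.
Proof.
move=> /memP[t ->]; elim: (spn_inj s r t) => [|k p w q z [[a ha] [b hb] _] _ [F0 IH]].
  by exists [::] => F _ _; rewrite mulr0 mul0r.
exists [:: a, b & F0] => F uF sF.
have [IH1 IH2] : vsum F * z = z /\ z * vsum F = z.
  by apply: IH => // v vF; apply: sF; rewrite !inE vF !orbT.
have aF : a \in F by apply: sF; rewrite inE eqxx.
have bF : b \in F by apply: sF; rewrite !inE eqxx orbT.
rewrite mulrDr mulrDl IH1 IH2 -scalerAr -scalerAl.
have [_ ea] := vsum_uv uF aF; have [eb _] := vsum_uv uF aF; have [_ eb'] := vsum_uv uF bF.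
have [[_ e1]|[]//] := uv_mon_l K a q ha.
have [[_ e2]|[]//] := uv_mon_r K b p hb.
by split; [rewrite -e1 mulrA eb|rewrite -e2 -mulrA eb'].
Qed.

Lemma local_unit2 x y : mem_lpa x -> mem_lpa y -> exists F : seq V, [/\ uniq F,
  vsum F * x = x, x * vsum F = x, vsum F * y = y & y * vsum F = y].
Proof.
move=> /local_unit[F1 h1] /local_unit[F2 h2]; exists (undup (F1 ++ F2)).
have [||e1 e2] := h1 (undup (F1 ++ F2)); first exact: undup_uniq.
  by move=> v vF; rewrite mem_undup mem_cat vF.
have [||e3 e4] := h2 (undup (F1 ++ F2)); first exact: undup_uniq.
  by move=> v vF; rewrite mem_undup mem_cat vF orbT.
by split=> //; apply: undup_uniq.
Qed.
End LocalUnits.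

(** * The boundary path representation *)

Section Representation.
Variables (V Ed : Type) (s r : Ed -> V) (K : fieldType).
Local Notation T := (lterm V Ed K).
Local Notation "x ≈ y" := (Defs.leq s r x y) (at level 70).

(* A boundary path is a maximal path: infinite, or ending in a vertex that is
   not regular, where it then stays forever with no edge. *)
Definition point := nat -> V * option Ed.
Definition boundary (x : point) : Prop := forall n,
  match x n with
  | (v, Some e) => s e = v /\ (x n.+1).1 = r e
  | (v, None) => ~ regular s v /\ x n.+1 = x n
  end.
Definition src (x : point) := (x 0%N).1.
Definition ptail (x : point) : point := fun n => x n.+1.
Definition pcons e (x : point) : point := fun n => if n is m.+1 then x m else (s e, Some e).

Lemma boundary_cons e x : boundary (pcons e x) <-> boundary x /\ src x = r e.
Proof.
split=> [h|[h hs] [|n]]; last by have := h n.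
  by split; [move=> n; have := h n.+1|have := h 0%N => -[]].
by [].
Qed.
Lemma boundary_tail x : boundary x -> boundary (ptail x).
Proof. by move=> h n; have := h n.+1. Qed.
Lemma pcons_tail e x : x 0%N = (s e, Some e) -> pcons e (ptail x) = x.
Proof. by move=> h; apply/funext => -[|n] //=. Qed.
Lemma src_tail e x : boundary x -> x 0%N = (s e, Some e) -> src (ptail x) = r e.
Proof. by move=> h h0; have := h 0%N; rewrite h0 => -[]. Qed.

(** A chosen outgoing edge is followed at each vertex, stopping only at sinks, which are not
    regular; at an infinite emitter the path is continued. *)
Lemma exists_boundary v : exists2 x, boundary x & src x = v.
Proof.
have hc w : {o : option Ed | match o with Some e => s e = w | None => sink s w end}.
  apply/cid; have [[e h]|h] := pselect (exists e, s e = w); first by exists (Some e).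
  by exists None => e he; apply: h; exists e.
pose nx (st : V * option Ed) := match st.2 with
  | Some e => (r e, sval (hc (r e))) | None => st end.
pose x n := iter n nx (v, sval (hc v)).
exists x => // n.
have inv : match x n with (w, Some e) => s e = w | (w, None) => sink s w end.
  rewrite /x; elim: n => [|n] /=; first by case: (hc v) => -[].
  case: (iter n nx _) => w [e|] //= _.
  by rewrite /nx /=; case: (hc (r e)) => -[].
rewrite -[x n.+1]/(nx (x n)) /nx; case: (x n) inv => w [e|] //= hw.
split=> // -[l [lnil [_ hl]]]; case: l lnil hl => // e l _ /(_ e) [_ h].
by apply: (hw e); apply: h; left.
Qed.

(** The integer coordinate carries the grading: a function supported in level [j] is sent by an edge
    to level [j + d]. For [d = 0] the coordinate is inert. *)
Definition Fn := point -> int -> K.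
Variable d : int.

(** An edge evaluates at the tail and a ghost edge at the prolonged path. Everything vanishes off
    the boundary paths, because [leq_ck2] needs a path at a regular vertex to have a first edge. *)
Fixpoint rho (t : T) (phi : Fn) : Fn :=
  match t with
  | LV v => fun x n => if `[< boundary x /\ src x = v >] then phi x n else 0
  | LE e => fun x n => if `[< boundary x /\ x 0%N = (s e, Some e) >]
              then phi (ptail x) (n - d) else 0
  | LS e => fun x n => if `[< boundary x /\ src x = r e >]
              then phi (pcons e x) (n + d) else 0
  | L0 => fun _ _ => 0
  | LAdd a b => fun x n => rho a phi x n + rho b phi x n
  | LScal k a => fun x n => k * rho a phi x n
  | LMul a b => rho a (rho b phi)
  end.

Lemma rho_lin t k phi psi x n :
  rho t (fun y m => k * phi y m + psi y m) x n = k * rho t phi x n + rho t psi x n.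
Proof.
elim: t phi psi x n => [v|e|e||a IHa b IHb|l a IHa|a IHa b IHb] phi psi x n /=.
- by case: asboolP; rewrite ?mulr0 ?addr0.
- by case: asboolP; rewrite ?mulr0 ?addr0.
- by case: asboolP; rewrite ?mulr0 ?addr0.
- by rewrite mulr0 addr0.
- by rewrite IHa IHb; ring.
- by rewrite IHa; ring.
- rewrite -IHa; congr rho; apply/funext => y; apply/funext => m; exact: IHb.
Qed.

Lemma rho_add t phi psi : rho t (fun y m => phi y m + psi y m) =
  fun x n => rho t phi x n + rho t psi x n.
Proof.
apply/funext => x; apply/funext => n; have := rho_lin t 1 phi psi x n; rewrite mul1r => <-.
by congr rho; apply/funext => y; apply/funext => m; rewrite mul1r.
Qed.
Lemma rho_scal t k phi : rho t (fun y m => k * phi y m) = fun x n => k * rho t phi x n.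
Proof.
apply/funext => x; apply/funext => n; have := rho_lin t (k - 1) phi phi x n.
rewrite mulrBl mul1r subrK => <-.
by congr rho; apply/funext => y; apply/funext => m; rewrite mulrBl mul1r subrK.
Qed.
Lemma rho_zero t : rho t (fun y m => 0) = fun x n => 0.
Proof.
apply/funext => x; apply/funext => n.
have := rho_scal t 0 (fun _ _ => 0) => /(congr1 (fun f => f x n)) /=.
by rewrite !mul0r.
Qed.

Lemma rho_leq a b : a ≈ b -> rho a = rho b.
Proof.
have ext (f g : Fn -> Fn) : (forall phi x n, f phi x n = g phi x n) -> f = g.
  by move=> h; apply/funext => phi; apply/funext => x; apply/funext => n.
elim=> {a b} /=.
- by [].
- by [].
- by move=> x y z _ -> _ ->.
- by move=> x x' y y' _ -> _ ->.
- by move=> k x x' _ ->.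
- by move=> x x' y y' _ -> _ ->.
- by move=> x y z; apply: ext => phi p n; rewrite /= addrA.
- by move=> x y; apply: ext => phi p n; rewrite /= addrC.
- by move=> x; apply: ext => phi p n; rewrite /= add0r.
- by move=> x; apply: ext => phi p n; rewrite /= mulN1r subrr.
- by move=> k x y; apply: ext => phi p n; rewrite /= mulrDr.
- by move=> k l x; apply: ext => phi p n; rewrite /= mulrDl.
- by move=> k l x; apply: ext => phi p n; rewrite /= mulrA.
- by move=> x; apply: ext => phi p n; rewrite /= mul1r.
- by [].
- by [].
- by move=> x y z; apply: ext => phi p n; rewrite rho_add.
- by [].
- by move=> k x y; apply: ext => phi p n; rewrite rho_scal.
- by move=> v; apply: ext => phi p n /=; case: asboolP.
- move=> v w nvw; apply: ext => phi p n /=; case: asboolP => // -[_ h1].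
  by case: asboolP => // -[_ h2]; case: nvw; rewrite -h1 -h2.
- move=> e; apply: ext => phi p n /=; case: asboolP => // h.
  by case: asboolP => // -[h1 h2]; case: h; rewrite /src h2.
- move=> e; apply: ext => phi p n /=; case: asboolP => // -[h1 h2].
  case: asboolP => // -[]; split; [exact: boundary_tail|exact: (src_tail h1)].
- by move=> e; apply: ext => phi p n /=; case: asboolP.
- move=> e; apply: ext => phi p n /=; case: asboolP => // h.
  by case: asboolP => // -[]; split=> //; apply/boundary_cons.
- move=> e; apply: ext => phi p n /=; case: asboolP => // h.
  case: asboolP => [_|[]]; last by split=> //; apply/boundary_cons.
  by rewrite addrK.
- move=> e f nef; apply: ext => phi p n /=; case: asboolP => // h.
  by case: asboolP => // -[_ [_ h2]]; case: nef.
move=> v l lnil nd hl; apply: ext => phi p n.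
(* A partial sum of [leq_ck2] acts as restriction to the paths whose first edge lies in [l'];
   absence of duplicates prevents double counting. *)
have aux (l' : seq Ed) : List.NoDup l' ->
    rho (lsum (List.map (fun e => LMul (LE e) (LS e)) l')) phi p n =
    if `[< boundary p /\ exists e, p 0%N = (s e, Some e) /\ List.In e l' >] then phi p n else 0.
  elim=> {l'} [|e l' ne _ IH] /=; first by case: asboolP => // -[_ [? []]].
  rewrite IH; case: asboolP => [[h1 h2]|h].
    rewrite asboolT; last by split; [apply: boundary_tail|apply: src_tail h1 h2].
    rewrite pcons_tail // subrK; case: asboolP => [[_ [f [hf hf']]]|_].
      by case: ne; move: hf; rewrite h2 => -[_ ->].
    by rewrite addr0 asboolT //; split=> //; exists e; split=> //; left.
  rewrite add0r; congr (if _ then _ else _); apply: asbool_equiv_eq.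
  split=> -[hb [f [hf hf']]]; split=> //; exists f; split=> //; first by right.
  by case: hf' => // ef; subst f; case: h.
rewrite aux //=; congr (if _ then _ else _); apply: asbool_equiv_eq.
split=> -[hb]; last by move=> [e [he /hl hel]]; split=> //; rewrite /src he.
move=> hs; split=> //; have := hb 0%N; rewrite -/(src p).
case E: (p 0%N) => [w [e|]]; move: hs; rewrite /src E /= => ->.
  by move=> [he _]; exists e; rewrite he; split=> //; apply/hl.
by move=> [[]]; exists l.
Qed.

Definition urho (u : ulpa s r K) (phi : Fn) : Fn :=
  fun x n => u.1 * phi x n + rho (lrep u.2) phi x n.

Lemma rho_lcl t : rho (lrep (lcl s r t)) = rho t.
Proof. exact/rho_leq/lclK. Qed.
Lemma urho_inj t : urho (inj s r t) = rho t.
Proof.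
apply/funext => phi; apply/funext => x; apply/funext => n.
by rewrite /urho rho_lcl mul0r add0r.
Qed.
Lemma rho_lrepD (p q : lpa s r K) phi x n :
  rho (lrep (p + q)) phi x n = rho (lrep p) phi x n + rho (lrep q) phi x n.
Proof.
by rewrite -{1}(lrepK p) -{1}(lrepK q) -lclD rho_lcl.
Qed.
Lemma rho_lrepZ k (q : lpa s r K) phi x n :
  rho (lrep (k *: q)) phi x n = k * rho (lrep q) phi x n.
Proof. by rewrite -{1}(lrepK q) -lclZ rho_lcl. Qed.
Lemma rho_lrepM (p q : lpa s r K) : rho (lrep (lmul p q)) = rho (lrep p) \o rho (lrep q).
Proof. by rewrite -{1}(lrepK p) -{1}(lrepK q) lmul_cl rho_lcl. Qed.

Lemma urhoD u w phi x n : urho (u + w) phi x n = urho u phi x n + urho w phi x n.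
Proof. by rewrite /urho /= rho_lrepD; ring. Qed.
Lemma urhoZ k u phi x n : urho (k *: u) phi x n = k * urho u phi x n.
Proof. by rewrite /urho /= rho_lrepZ mulrDr mulrA. Qed.
Lemma urho0 phi x n : urho 0 phi x n = 0.
Proof. by rewrite -(scale0r 0) urhoZ mul0r. Qed.
Lemma urhoM u w phi : urho (u * w) phi = urho u (urho w phi).
Proof.
apply/funext => x; apply/funext => n; rewrite /urho /= !rho_lrepD !rho_lrepZ rho_lrepM /=.
by rewrite rho_add rho_scal; ring.
Qed.
Lemma urho_lin u k phi psi x n :
  urho u (fun y m => k * phi y m + psi y m) x n = k * urho u phi x n + urho u psi x n.
Proof. by rewrite /urho rho_lin; ring. Qed.
Lemma urho_zero u x n : urho u (fun y m => 0) x n = 0.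
Proof. by rewrite /urho rho_zero mulr0 addr0. Qed.
Lemma urho_sum u (I : Type) (l : seq I) (c : I -> K) (F : I -> Fn) x n :
  urho u (fun y m => \sum_(i <- l) c i * F i y m) x n = \sum_(i <- l) c i * urho u (F i) x n.
Proof.
elim: l => [|i l IH].
  rewrite [RHS]big_nil -[RHS](urho_zero u x n); congr urho.
  by apply/funext => y; apply/funext => m; rewrite big_nil.
rewrite big_cons -IH -urho_lin; congr urho.
by apply/funext => y; apply/funext => m; rewrite big_cons.
Qed.
Lemma urho_uv v phi x n :
  urho (uv s r K v) phi x n = if `[< boundary x /\ src x = v >] then phi x n else 0.
Proof. by rewrite urho_inj. Qed.
End Representation.

(** * Reading off degree-zero coefficients *)

Section Evaluation.
Variables (V Ed : Type) (s r : Ed -> V) (K : fieldType).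
Local Notation uv := (uv s r K).

Lemma rho_deg k (t : lterm V Ed K) j phi : Defs.hom s r k t ->
  (forall x n, n <> j -> phi x n = 0) ->
  forall x n, n <> j + k -> rho s r 1 t phi x n = 0.
Proof.
move=> h; elim: h j phi => {k t} /=.
- by move=> v j phi h x n nj; case: asboolP => // _; apply: h; rewrite addr0 in nj.
- move=> e j phi h x n nj; case: asboolP => // _; apply: h; lia.
- move=> e j phi h x n nj; case: asboolP => // _; apply: h; lia.
- by [].
- by move=> n x y _ IHx _ IHy j phi h p m nm; rewrite (IHx j) // (IHy j) // addr0.
- by move=> n k x _ IHx j phi h p m nm; rewrite (IHx j) // mulr0.
- move=> m n x y _ IHx _ IHy j phi h p k nk; apply: (IHx (j + n)); last lia.
  by move=> q i ni; apply: (IHy j).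
- by move=> n x y _ IH /rho_leq <-.
Qed.

(* The matrix coefficient of the graded representation at a boundary path
   starting in [w] separates [w] from all other degrees. *)
Lemma exists_eval w : exists ev : ulpa s r K -> K, [/\
  forall x y, ev (x + y) = ev x + ev y, forall k x, ev (k *: x) = k * ev x,
  ev (uv w) = 1 & forall n x, spn (Mon s r (eq n)) x -> n <> 0 -> ev x = 0].
Proof.
have [p0 hb hs] := exists_boundary s r w.
pose de : Fn V Ed K := fun x n => if `[< x = p0 /\ n = 0 >] then 1 else 0.
exists (fun u => urho 1 u de p0 0); split.
- by move=> x y; apply: urhoD.
- by move=> k x; apply: urhoZ.
- by rewrite urho_uv asboolT // /de asboolT.
move=> n x /hom_spn[t ht ->] nn; rewrite urho_inj; apply: (rho_deg ht (j := 0)).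
  by move=> y m nm; rewrite /de; case: asboolP => // -[].
by rewrite add0r => ?; apply: nn.
Qed.

Lemma uv_neq0 v : uv v <> 0.
Proof.
have [ev [hD hZ h1 _]] := exists_eval v => h0; have := hZ 0 0.
by rewrite -h0 scale0r -h0 h1 mul0r => /eqP; rewrite oner_eq0.
Qed.
End Evaluation.

(** * Necessity: families of orthogonal projections *)

Section Necessity.
Variables (V Ed : Type) (s r : Ed -> V) (K : fieldType).
Local Notation U := (ulpa s r K).
Local Notation uv := (uv s r K).
Local Notation ue := (ue s r K).
Local Notation us := (us s r K).
Local Notation pth := (pth s r K).
Local Notation gst := (gst s r K).
Local Notation mon := (mon s r K).
Local Notation walk := (walk s r).

(* The common consequence of all the Baer conditions from which the graph
   conditions are extracted. *)
Definition weak_Baer := forall v (S : U -> Prop),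
  (forall x, S x -> spn (Mon s r (eq 0)) x /\ uv v * x * uv v = x) ->
  exists f, [/\ mem_lpa f, forall x, S x -> x * f = 0 &
    forall y, mem_lpa y -> uv v * y * uv v = y -> (forall x, S x -> x * y = 0) -> f * y = y].

Definition evaluation w (ev : U -> K) := [/\
  forall x y, ev (x + y) = ev x + ev y, forall k x, ev (k *: x) = k * ev x,
  ev (uv w) = 1 & forall n x, spn (Mon s r (eq n)) x -> n <> 0 -> ev x = 0].

Lemma eval0 w ev : evaluation w ev -> ev 0 = 0.
Proof. by case=> _ hZ _ _; rewrite -(scale0r 0) hZ mul0r. Qed.

Section Family.
Variables (v : V) (p : nat -> seq Ed) (w : nat -> V).
Hypothesis pw : forall n, walk v (p n) (w n).
Hypothesis orth : forall n m, n <> m -> uv (w n) * gst (p n) * pth (p m) * uv (w m) = 0.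
Let A n := uv (w n) * gst (p n).
Let B n := pth (p n) * uv (w n).
Hypothesis asymp : forall P W Q, Mon s r anydeg P W Q -> exists c N, forall n ev, (N <= n)%N ->
  evaluation (w n) ev -> ev (A n * mon P W Q * B n) = c.

(** The hypothesis [asymp] is about monomials and extends linearly to the generator [f]. Its
    constant must be the same for every evaluation, since an unrelated one is picked at each
    [w n]. *)
Lemma weak_Baer_family : ~ weak_Baer.
Proof.
have AB n : A n * B n = uv (w n) by rewrite /A /B mulrA (gst_pth' K (pw n)) uvv.
have ABne n m : n <> m -> A n * B m = 0 by move=> h; rewrite /A /B mulrA orth.
pose Y n := mon (p n) (w n) (p n).
have YE n : Y n = B n * A n by rewrite /Y /mon /A /B !mulrA -(mulrA _ _ (uv _)) uvv.
have AY n : A n * Y n = A n by rewrite YE mulrA AB /A mulrA uvv.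
have YB n : Y n * B n = B n by rewrite YE -mulrA AB /B -mulrA uvv.
have Yv n : uv v * Y n * uv v = Y n.
  have [[_ ->]|[]//] := uv_mon_l K v (p n) (pw n).
  by have [[_ ->]|[]//] := uv_mon_r K v (p n) (pw n).
have Y0 n : spn (Mon s r (eq 0)) (Y n).
  by apply: spn_mon; split; [exists v|exists v|rewrite /mdeg subrr].
move=> WB; have [|f [fm fS fY]] := WB v (fun x => exists n, x = Y n.*2).
  by move=> x [n ->].
have fodd n : f * Y n.*2.+1 = Y n.*2.+1.
  apply: fY => //; first exact/mem_spn/(spn_any (Y0 _)).
  move=> x [m ->]; rewrite !YE -mulrA (mulrA (A _)) ABne ?mul0r ?mulr0 //; lia.
have [c [N hc]] : exists c N, forall n ev, (N <= n)%N ->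
    evaluation (w n) ev -> ev (A n * f * B n) = c.
  have [t ->] := memP fm.
  elim: (spn_inj s r t) => [|k P W Q x hC _ [c [N IH]]].
    by exists 0, 0%N => n ev _ /eval0; rewrite mulr0 mul0r.
  have [c' [N' h']] := asymp hC; exists (k * c' + c), (N + N')%N => n ev hn hev.
  have [hD hZ _ _] := hev; rewrite mulrDr mulrDl hD IH //; last lia.
  by rewrite -scalerAr -scalerAl hZ h' //; lia.
have [ev hev] := exists_eval s r K (w N.*2).
have [ev' hev'] := exists_eval s r K (w N.*2.+1).
have c0 : c = 0.
  rewrite -(hc N.*2 ev) //; last lia.
  by rewrite -AY -(mulrA (A _)) fS ?mulr0 ?mul0r ?(eval0 hev) //; exists N.
have : c = 1.
  rewrite -(hc N.*2.+1 ev') //; last lia.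
  by rewrite -(YB N.*2.+1) mulrA -(mulrA (A _)) fodd AY AB; case: hev'.
by rewrite c0 => /esym/eqP; rewrite oner_eq0.
Qed.
End Family.

Lemma infinite_emitter v : ~ regular s v -> ~ sink s v ->
  exists e : nat -> Ed, injective e /\ forall n, s (e n) = v.
Proof.
move=> nreg nsink.
have hc (l : seq Ed) : {e | s e = v /\ ~ List.In e l}.
  apply/cid; apply: contrapT => h; apply: nreg.
  have dec (e f : Ed) : {e = f} + {e <> f} by apply: pselect.
  (* If [l] contained all edges leaving [v], then filtering it and removing duplicates would give
     the exact enumeration that [regular] asks for. Hence a fresh edge exists outside every list. *)
  exists (List.nodup dec (List.filter (fun e => `[< s e = v >]) l)).
  have hin e : s e = v <-> List.In e (List.nodup dec (List.filter (fun e => `[< s e = v >]) l)).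
    rewrite List.nodup_In List.filter_In; split=> [he|[_ /asboolP//]].
    split; last exact/asboolP.
    by apply: contrapT => ne; apply: h; exists e.
  split; last by split=> //; apply: List.NoDup_nodup.
  by move=> h0; apply: nsink => e /hin; rewrite h0.
pose L n := iter n (fun l => sval (hc l) :: l) [::].
pose e n := sval (hc (L n)).
have hL n m : (n < m)%N -> List.In (e n) (L m).
  elim: m => // m IH; rewrite ltnS leq_eqVlt => /orP[/eqP->|/IH h]; first by left.
  by right.
exists e; split; last by move=> n; rewrite /e; case: (hc _) => ? [].
have ne n m : (n < m)%N -> e n <> e m.
  by move=> /hL hi enm; have [_] := svalP (hc (L m)); rewrite -/(e m) -enm.
move=> n m enm; case: (ltngtP n m) => // /ne; [by move/(_ enm)|by move/(_ (esym enm))].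
Qed.

Lemma eventually_notin (T : Type) (e : nat -> T) (l : seq T) : injective e ->
  exists N, forall n, (N <= n)%N -> ~ List.In (e n) l.
Proof.
move=> inj_e; elim: l => [|a l [N IH]]; first by exists 0%N => n _ [].
have [[m em]|h] := pselect (exists m, e m = a).
  exists (maxn N m.+1) => n hn [ha|]; last by apply: IH; lia.
  have : m = n by apply: inj_e; rewrite em.
  by lia.
by exists N => n hn [ha|]; [apply: h; exists n|apply: IH].
Qed.

(** The paths of the family are the single edges of an infinite emitter. Once [e n] avoids the edges
    of [P] and [Q], a monomial contributes only if it is the vertex [v] itself, and then it
    contributes [1]. *)
Lemma weak_Baer_row_finite : weak_Baer -> row_finite s.
Proof.
move=> WB v; apply: contrapT => h.
have [||e [inj_e se]] := @infinite_emitter v.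
- by move=> h'; apply: h; left.
- by move=> h'; apply: h; right.
apply: (@weak_Baer_family v (fun n => [:: e n]) (fun n => r (e n))) WB => //.
  move=> n m nm; rewrite gst_cons pth_cons gst_nil pth_nil mul1r mulr1.
  rewrite -(mulrA (uv _)) uck1' ?mulr0 ?mul0r //.
  by move=> /inj_e.
move=> P W Q _; have [N hN] := eventually_notin (P ++ Q) inj_e.
have A1 n : uv (r (e n)) * gst [:: e n] = us (e n).
  by rewrite gst_cons gst_nil mul1r urs.
have B1 n : pth [:: e n] * uv (r (e n)) = ue (e n).
  by rewrite pth_cons pth_nil mulr1 uer.
exists (if `[< [/\ P = [::], Q = [::] & W = v] >] then 1 else 0), N => n ev hn hev.
rewrite A1 B1; have {hN}hN := hN n hn.
case: P hN => [|a P] hN; last first.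
  rewrite asboolF; last by case.
  rewrite /mon pth_cons !mulrA uck1' ?mul0r ?(eval0 hev) //.
  by move=> ha; apply: hN; left.
case: Q hN => [|b Q] hN; last first.
  rewrite asboolF; last by case.
  rewrite /mon gst_cons -!mulrA uck1' ?mulr0 ?(eval0 hev) //.
  by move=> ha; apply: hN; left.
rewrite mon_uv; case: asboolP => [[_ _ ->]|nW].
  by rewrite -(se n) uss uck1; case: hev.
rewrite -(uss _ _ _ (e n)) -!mulrA (mulrA _ (uv W)) uvw ?mul0r ?mulr0 ?(eval0 hev) //.
by rewrite se => hv; apply: nW.
Qed.

Lemma walk_mkseq (a : nat -> Ed) n : inf_path s r a -> walk (s (a 0%N)) (mkseq a n) (s (a n)).
Proof.
move=> ha; elim: n => // n IH; rewrite -(addn1 n) /mkseq iotaD map_cat addn1.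
by apply/walk_cat; exists (s (a n)); rewrite //= add0n ha.
Qed.

(** * Paths that follow an infinite path and then leave it *)

Section Exits.
Variable a : nat -> Ed.
Hypothesis ha : inf_path s r a.
Variables (m : nat -> nat) (g : nat -> Ed).
Hypothesis m_mono : forall i j, (i < j)%N -> (m i < m j)%N.
Hypothesis gs : forall n, s (g n) = s (a (m n)).
Hypothesis gne : forall n, g n <> a (m n).
Let p n := mkseq a (m n) ++ [:: g n].

Lemma exit_walk n : walk (s (a 0%N)) (p n) (r (g n)).
Proof. by apply/walk_cat; exists (s (a (m n))); [exact: walk_mkseq|]. Qed.

Lemma exit_prefix n q t : p n = q ++ t -> (size q <= m n)%N -> q = mkseq a (size q).
Proof.
move=> pq sq; apply: (@eq_from_nth _ (g n)); rewrite ?size_mkseq // => i iq.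
rewrite nth_mkseq //.
have : nth (g n) (p n) i = a i.
  by rewrite /p nth_cat size_mkseq (leq_trans iq sq) nth_mkseq // (leq_trans iq sq).
by rewrite pq nth_cat iq.
Qed.

Lemma size_p n : size (p n) = (m n).+1.
Proof. by rewrite /p size_cat size_mkseq addn1. Qed.

Lemma exit_not_prefix n k t : (n < k)%N -> p k = p n ++ t -> False.
Proof.
move=> nk h; have := congr1 (fun l => nth (g n) l (m n)) h.
rewrite {1}/p !nth_cat size_mkseq m_mono // nth_mkseq ?m_mono // size_p ltnSn.
by rewrite size_mkseq ltnn subnn /= => /esym/gne.
Qed.

(** No exit path is a prefix of another, whence orthogonality. For [n] beyond [size P + size Q] the
    path [p n] is longer than [P] and [Q], so a monomial contributes only if both are initial
    segments of [a]. If their lengths differ, the product has nonzero degree and the evaluation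
    kills it; if they agree, then [P = Q], and the product is a vertex or zero according to [W]. *)
Lemma weak_Baer_exits : ~ weak_Baer.
Proof.
apply: (@weak_Baer_family _ p (fun n => r (g n)) exit_walk).
  move=> n k nk; have [[t ht]|[[t ht]|//]] := gst_pth_cases K (exit_walk n) (exit_walk k).
    case: (ltngtP n k) => // nk'; first by case: (exit_not_prefix nk' ht).
    have := congr1 size ht; rewrite size_cat !size_p => h; have := m_mono nk'; lia.
  case: (ltngtP n k) => // nk'; last by case: (exit_not_prefix nk' ht).
  have := congr1 size ht; rewrite size_cat !size_p => h; have := m_mono nk'; lia.
have m_ge n : (n <= m n)%N by elim: n => // n IH; apply: leq_ltn_trans IH (m_mono (ltnSn n)).
move=> P W Q [[b hb] [c hc] _].
exists (if `[< [/\ P = Q, P = mkseq a (size P) & W = s (a (size P))] >] then 1 else 0).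
exists (size P + size Q).+1 => n ev hn hev; have := m_ge n => hmn.
have zero : uv (r (g n)) * gst (p n) * mon P W Q * (pth (p n) * uv (r (g n))) =
  (uv (r (g n)) * gst (p n) * pth P * uv W) * (uv W * gst Q * pth (p n) * uv (r (g n))).
  by rewrite /mon !mulrA -(mulrA _ (uv W) (uv W)) uvv.
have [hP|nP] := pselect (P = mkseq a (size P)); last first.
  rewrite asboolF; last by case.
  have [[t ht]|[[t ht]|h0]] := gst_pth_cases K (exit_walk n) hb.
  - by have := congr1 size ht; rewrite size_cat size_p; lia.
  - by case: nP; apply: exit_prefix ht _; lia.
  by rewrite zero h0 mul0r (eval0 hev).
have [hQ|nQ] := pselect (Q = mkseq a (size Q)); last first.
  rewrite asboolF; last by case=> h1 h2 _; apply: nQ; rewrite -h1.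
  have [[t ht]|[[t ht]|h0]] := gst_pth_cases K hc (exit_walk n).
  - by case: nQ; apply: exit_prefix ht _; lia.
  - by have := congr1 size ht; rewrite size_cat size_p; lia.
  by rewrite zero h0 mulr0 (eval0 hev).
have [sPQ|nPQ] := eqVneq (size P) (size Q); last first.
  rewrite asboolF; last by case=> h1; move: nPQ; rewrite h1 eqxx.
  have [_ _ _ hdeg] := hev; apply: (hdeg (mdeg P Q)); last by rewrite /mdeg; move/eqP: nPQ; lia.
  have h1 : spn (Mon s r (eq (mdeg [::] (p n)))) (uv (r (g n)) * gst (p n)).
    rewrite -[X in X * _]mul1r -pth_nil; apply: spn_mon; split=> //; first by exists (r (g n)).
    by eexists; apply: exit_walk.
  have h2 : spn (Mon s r (eq (mdeg (p n) [::]))) (pth (p n) * uv (r (g n))).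
    rewrite -[X in spn _ X]mulr1 -gst_nil; apply: spn_mon; split=> //; last by exists (r (g n)).
    by eexists; apply: exit_walk.
  have h3 : spn (Mon s r (eq (mdeg P Q))) (mon P W Q).
    by apply: spn_mon; split; [exists b|exists c|].
  have h4 : spn (Mon s r (eq (mdeg [::] (p n) + mdeg P Q)))
      (uv (r (g n)) * gst (p n) * mon P W Q) by apply: spn_mul h1 h3 => x y <- <-.
  apply: spn_mul h4 h2.
  by move=> x y <- <-; rewrite /mdeg /=; lia.
have PQ : P = Q by rewrite hP hQ sPQ.
have [t ht] : exists t, p n = P ++ t.
  exists (drop (size P) (p n)); rewrite -{1}(cat_take_drop (size P) (p n)); congr (_ ++ _).
  rewrite [RHS]hP /p take_cat size_mkseq; case: ltnP => hs; last by lia.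
  by rewrite /mkseq -map_take take_iota; congr map; congr iota; lia.
have hw := exit_walk n; rewrite ht in hw; move/walk_cat: hw => [W' h1 h2].
have eW' : W' = s (a (size P)).
  by apply: walk_inj h1 _; rewrite hP size_mkseq; apply: walk_mkseq.
rewrite zero -PQ.
have e1 : uv W * gst P * pth (p n) * uv (r (g n)) = uv W * uv W' * pth t * uv (r (g n)).
  have e2 z : gst P * (pth P * (uv W' * z)) = uv W' * z by rewrite !mulrA (gst_pth K h1).
  by rewrite ht pth_cat -!mulrA -(uv_pth K h2) e2 (mulrA (uv W')) uvv.
rewrite e1; case: asboolP => [[_ _ eW]|nW].
  rewrite eW -eW' uvv; have [_ _ <- _] := hev; congr ev.
  rewrite -!mulrA -(uv_pth K h2) (mulrA (uv W')) uvv (mulrA (uv W')) uvv (uv_pth K h2).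
  by rewrite (mulrA (pth P)) -pth_cat -ht !mulrA (gst_pth' K (exit_walk n)) uvv.
rewrite (@uvw _ _ _ _ _ W W') ?mul0r ?mulr0 ?(eval0 hev) // => eW.
by apply: nW; rewrite -eW'.
Qed.
End Exits.

(** Otherwise exits can be chosen recursively, each strictly beyond the preceding one, as
    [weak_Baer_exits] requires. *)
Lemma weak_Baer_few_exits (a : nat -> Ed) : weak_Baer -> inf_path s r a ->
  exists n, forall m f, (n <= m)%N -> s f = s (a m) -> f = a m.
Proof.
move=> WB ha; apply: contrapT => h.
have hc n : {mf : nat * Ed | (n <= mf.1)%N /\ s mf.2 = s (a mf.1) /\ mf.2 <> a mf.1}.
  apply/cid; apply: contrapT => h'; apply: h; exists n => m f nm sf.
  by apply: contrapT => nf; apply: h'; exists (m, f).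
pose M n := iter n (fun mf => sval (hc mf.1.+1)) (sval (hc 0%N)).
have hM n : s (M n).2 = s (a (M n).1) /\ (M n).2 <> a (M n).1.
  by case: n => [|n]; rewrite /M /=; [case: (svalP (hc 0%N))|case: (svalP (hc (M n).1.+1))].
have mono n : ((M n).1 < (M n.+1).1)%N.
  by have [h0 _] := svalP (hc (M n).1.+1); apply: h0.
apply: (@weak_Baer_exits a ha (fun n => (M n).1) (fun n => (M n).2)) WB.
- move=> i; elim=> // j IH; rewrite ltnS leq_eqVlt => /orP[/eqP->//|/IH h'].
  exact: ltn_trans h' (mono j).
- by move=> n; case: (hM n).
- by move=> n; case: (hM n).
Qed.
End Necessity.

(** * Terminal vertices *)

Section Graphs.
Local Open Scope nat_scope.
Variables (V Ed : Type) (s r : Ed -> V).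
Local Notation walk := (walk s r).

Lemma Lmap_map (A B : Type) (f : A -> B) l : List.map f l = map f l.
Proof. by elim: l => //= a l ->. Qed.

Lemma In_nth (A : Type) (x0 x : A) l : List.In x l -> exists2 i, i < size l & nth x0 l i = x.
Proof.
elim: l => //= a l IH [->|/IH[i il ei]]; first by exists 0.
by exists i.+1.
Qed.

Lemma In_iota x i k : List.In x (iota i k) -> i <= x < i + k.
Proof.
elim: k i => //= k IH i [->|/IH]; first by lia.
by lia.
Qed.

Lemma NoDup_map_iota (A : Type) (f : nat -> A) i k :
  (forall x y, i <= x -> x < y -> y < i + k -> f x <> f y) ->
  List.NoDup (List.map f (iota i k)).
Proof.
elim: k i => [|k IH] i h /=; first by constructor.
constructor; last by apply: IH => x y *; apply: h; lia.
by move=> /List.in_map_iff[x [fx /In_iota hx]]; apply: (h i x) => //; lia.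
Qed.

Lemma epath_walk e c : epath s r (e :: c) -> walk (s e) (e :: c) (r (last e c)).
Proof.
elim: c e => [|f c IH] e //= [h1 h2]; split=> //.
by have := IH f h2; rewrite h1 /=.
Qed.

Lemma epath_nth d c i : epath s r c -> i.+1 < size c -> r (nth d c i) = s (nth d c i.+1).
Proof.
elim: c i => [|e [|f c] IH] [|i] //= [h1 h2] hi //.
exact: (IH i).
Qed.

Lemma epath_map_iota a i k : inf_path s r a -> epath s r (List.map a (iota i k)).
Proof.
by move=> ha; elim: k i => [|[|k] IH] i //=; split=> //; apply: (IH i.+1).
Qed.

Lemma last_map_iota (A : Type) (a : nat -> A) i k :
  last (a i) (List.map a (iota i.+1 k)) = a (i + k).
Proof. by rewrite Lmap_map last_map; elim: k i => [|k IH] i; rewrite ?addn0 //= IH addSnnS. Qed.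

(** A return with no shorter return inside it has pairwise distinct sources, as [is_cycle]
    demands. *)
Lemma find_cycle a i j : inf_path s r a -> i < j -> s (a i) = s (a j) ->
  exists i' k, i <= i' /\ is_cycle s r (List.map a (iota i' k.+1)).
Proof.
move=> ha; have [n] := ubnP (j - i); elim: n i j => // n IH i j jin ij sij.
have [[x [y [xi xy yj sxy]]]|h] :=
    pselect (exists x y, [/\ i <= x, x < y, y < j & s (a x) = s (a y)]).
  by have [|i' [k [h1 h2]]] := IH x y _ xy sxy; [lia|exists i', k; split=> //; lia].
exists i, (j - i).-1; split=> //.
have ej : i + (j - i).-1 = j.-1 by lia.
split; first exact: epath_map_iota.
split; first by rewrite last_map_iota ej ha sij; congr (s (a _)); lia.
change (List.NoDup (List.map s (List.map a (iota i (j - i).-1.+1)))).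
rewrite List.map_map.
apply: NoDup_map_iota => x y ix xy yj sxy; apply: h; exists x, y; split=> //; lia.
Qed.

(** On a line, walks from [t] are determined by their length. So [term1] says that no vertex recurs,
    and [term2] that [c] is the shortest return to [t]. *)
Definition line t := forall p w e f, walk t p w -> s e = w -> s f = w -> e = f.
Definition term1 t := line t /\ forall p q w, walk t p w -> walk t q w -> size p = size q.
Definition term2 t c := [/\ line t, c <> [::], walk t c t &
  forall l, l <> [::] -> walk t l t -> size c <= size l].
Definition term t := term1 t \/ exists c, term2 t c.

(* [good v]: the tree of paths issued from [v], pruned at terminal vertices, is finite. *)
Inductive good (v : V) : Prop :=
  | good_term : term v -> good v
  | good_reg : regular s v -> (forall e, s e = v -> good (r e)) -> good v.

Lemma term2_of_closed t l : line t -> l <> [::] -> walk t l t -> exists c, term2 t c.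
Proof.
move=> lt; have [n] := ubnP (size l); elim: n l => // n IH l ln lnil wl.
have [[c [h1 h2 h3]]|h] := pselect (exists c, [/\ c <> [::], walk t c t & size c < size l]).
  by apply: (IH c) => //; lia.
exists l; split=> // c h1 h2; rewrite leqNgt; apply/negP => h3; apply: h.
by exists c.
Qed.

(** Without exits no walk leaves the vertices of the cycle ([stay]), and each of them emits a single
    edge. *)
Lemma term2_of_cycle e c : no_exit s r -> is_cycle s r (e :: c) -> exists c', term2 (s e) c'.
Proof.
move=> ne cyc; have [ep [se nd]] := cyc.
have wc : walk (s e) (e :: c) (s e) by rewrite {2}se; apply: epath_walk.
have stay p v w : List.In v (List.map s (e :: c)) -> walk v p w ->
    List.In w (List.map s (e :: c)).
  elim: p v => [|f p IH] v; first by move=> h <-.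
  move=> /List.in_map_iff[g [<- gc]] [sf]; have {sf f} -> := ne _ cyc g gc f sf.
  apply: IH; have [l1 [l2 hl]] := List.in_split _ _ gc.
  have /walk_cat[u _ [_]] : walk (s e) (l1 ++ g :: l2) (s e) by rewrite -[l1 ++ _]hl.
  case: l2 hl => [|f l2] hl /=; first by move=> ->; left.
  move=> [<- _]; right; rewrite -/(List.map s c); apply: List.in_map.
  case: l1 hl => [|b l1] [_ ->]; first by left.
  by apply/List.in_or_app; right; right; left.
apply: (@term2_of_closed _ (e :: c)) => // p w f g hp.
have /List.in_map_iff[b [<- bc]] := stay _ _ _ (or_introl erefl) hp.
by move=> /(ne _ cyc b bc) -> /(ne _ cyc b bc).
Qed.

Lemma sink_term t : sink s t -> term t.
Proof.
move=> st; left; split.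
  by case=> [|g p] w e f /=; [move=> <- /st|move=> [/st]].
by case=> [|g p] [|h q] w //=; [move=> _ [/st]|move=> [/st]|move=> [/st]].
Qed.

(** An argument in the style of König: sinks are terminal, hence a vertex that is not good is
    regular and has an edge to another such vertex. *)
Lemma not_good_path v : row_finite s -> ~ good v ->
  exists a, inf_path s r a /\ forall n, ~ good (s (a n)).
Proof.
move=> rf ngv.
have hc (w : {w | ~ good w}) : {e | s e = sval w /\ ~ good (r e)}.
  apply/cid; case: w => w ng /=; apply: contrapT => h; apply: ng.
  have [reg|/sink_term] := rf w; last exact: good_term.
  by apply: good_reg => // e se; apply: contrapT => ng; apply: h; exists e.
pose nx (w : {w | ~ good w}) : {w | ~ good w} := exist _ (r (sval (hc w))) (proj2 (svalP (hc w))).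
pose W n := iter n nx (exist _ v ngv).
exists (fun n => sval (hc (W n))); split.
  by move=> n; have [-> _] := svalP (hc (W n.+1)).
by move=> n; have [-> _] := svalP (hc (W n)); apply: (svalP (W n)).
Qed.

(** Either way in which the path of [not_good_path] can end puts a terminal vertex on it: a cycle
    gives [term2], and an exit-free tail without cycles gives [term1], because a repeated vertex
    would produce a cycle by [find_cycle]. *)
Lemma C1_good v : row_finite s -> no_exit s r -> all_inf_paths_end s r -> good v.
Proof.
move=> rf ne end_; apply: contrapT => /(not_good_path rf)[a [ha ng]].
have [n [[nocyc noex]|[c [cyc hc]]]] := end_ _ ha; last first.
  case: c cyc hc => [|e c] //= cyc hc; have := hc 0; rewrite mod0n addn0 /= => an.
  by apply: (ng n); apply/good_term; right; rewrite an; apply: term2_of_cycle cyc.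
have foll p i w : n <= i -> walk (s (a i)) p w -> w = s (a (i + size p)).
  elim: p i => [|e p IH] i ni /=; first by rewrite addn0 => ->.
  move=> [/(noex _ _ ni) ->]; rewrite ha => /IH ->; last by lia.
  by rewrite addSnnS.
apply: (ng n); apply/good_term; left; split.
  move=> p w e f /(foll _ _ _ (leqnn n)) ->.
  by move=> /noex -> ; rewrite ?leq_addr // => /noex ->; rewrite ?leq_addr.
move=> p q w /(foll _ _ _ (leqnn n)) -> /(foll _ _ _ (leqnn n)) e.
have aux i j : i < j -> s (a (n + i)) = s (a (n + j)) -> False.
  move=> ij /(find_cycle ha)[|i' [k [h1 h2]]]; first by lia.
  by apply: nocyc h2; lia.
by case: (ltngtP (size p) (size q)) => // h; [case: (aux _ _ h e)|case: (aux _ _ h (esym e))].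
Qed.

(** By the pigeonhole principle the path of [not_good_path] revisits a vertex, so it runs through a
    cycle, whose vertices are terminal. *)
Lemma finite_good v : finite_graph s -> no_exit s r -> good v.
Proof.
move=> [rf [l hl]] ne; apply: contrapT => /(not_good_path rf)[a [ha ng]].
have [i [j [ij sij]]] : exists i j, i < j /\ s (a i) = s (a j).
  apply: contrapT => h; have [|N /(_ N (leqnn N))] := @eventually_notin _ (s \o a) l; last exact.
  move=> i j /= sij; case: (ltngtP i j) => // ij; case: h; first by exists i, j.
  by exists j, i.
have [i' [k [_ cyc]]] := find_cycle ha ij sij.
by apply: (ng i'); apply/good_term; right; apply: term2_of_cycle cyc.
Qed.

Variable K : fieldType.

(** Running around the cycle forever meets every exit infinitely often, which [weak_Baer_few_exits]
    forbids. *)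
Lemma weak_Baer_no_exit : weak_Baer s r K -> no_exit s r.
Proof.
move=> WB c cyc e ec f sf.
have k0 : 0 < size c by case: c cyc {ec}.
pose a n := nth e c (n %% size c).
have ha : inf_path s r a.
  move=> n; rewrite /a -addn1 -[in RHS]modnDml; have := ltn_pmod n k0.
  move: (n %% _) => i; rewrite leq_eqVlt => /orP[/eqP ik|ik].
    rewrite addn1 ik modnn; case: c cyc ik {ec k0 a} => [|g c] //= [_ [sg _]] [->].
    by rewrite sg (last_nth e) /=.
  by rewrite addn1 (modn_small ik); apply: epath_nth => //; case: c cyc {ec k0 a ik} => // ? ? [].
have [N hN] := weak_Baer_few_exits WB ha; have [i ic ei] := In_nth e ec.
have am : a (N * size c + i) = e by rewrite /a modnMDl modn_small.
by rewrite -am; apply: hN; [nia|rewrite am].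
Qed.

(** Past the last exit each edge is determined by its source, so a cycle found there must repeat
    forever. *)
Lemma weak_Baer_paths_end : weak_Baer s r K -> all_inf_paths_end s r.
Proof.
move=> WB a ha; have [N hN] := weak_Baer_few_exits WB ha.
have [[i [k [iN cyc]]]|h] := pselect (exists i k, N <= i /\ is_cycle s r (List.map a (iota i k))).
  case: k cyc => // k cyc; exists i; right.
  exists (List.map a (iota i k.+1)); split=> // j.
  have [_ [sk _]] := cyc; rewrite last_map_iota ha in sk.
  have per m : a (i + k.+1 + m) = a (i + m).
    elim: m => [|m IH]; first by rewrite !addn0; apply: hN; rewrite // sk addnS.
    by apply: hN; [lia|rewrite !(addnS _ m) -!ha IH].
  have perq q m : a (i + (q * k.+1 + m)) = a (i + m).
    by elim: q => // q IH; rewrite -IH -[RHS]per; congr a; lia.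
  rewrite Lmap_map size_map size_iota {1}(divn_eq j k.+1) perq.
  have jk : j %% k.+1 < k.+1 by apply: ltn_pmod.
  by rewrite (nth_map 0) ?size_iota // nth_iota.
exists N; left; split; last by move=> m f; apply: hN.
by move=> i k iN cyc; apply: h; exists i, k.
Qed.
End Graphs.

(** * Rows over terminal vertices *)

Section Terminal.
Variables (V Ed : Type) (s r : Ed -> V) (K : fieldType).
Local Notation U := (ulpa s r K).
Local Notation uv := (uv s r K).
Local Notation ue := (ue s r K).
Local Notation us := (us s r K).
Local Notation pth := (pth s r K).
Local Notation gst := (gst s r K).
Local Notation mon := (mon s r K).
Local Notation walk := (walk s r).
Local Notation line := (line s r).
Local Notation term := (term s r).
Implicit Types (x y z : U) (t w : V) (p q : seq Ed).

Inductive dec : U -> Prop :=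
  | dec0 : dec 0
  | decS v p t x : walk v p t -> term t -> dec x -> dec (mon p t p + x).

Lemma decD x y : dec x -> dec y -> dec (x + y).
Proof.
by move=> dx dy; elim: dx => [|v p t z h1 h2 _ IH]; rewrite ?add0r -?addrA //; apply: decS h1 _ _.
Qed.

(** At a regular vertex, expand by [uck2] and insert the decomposition of [r e] between [e] and its
    ghost edge. *)
Lemma good_dec v : good s r v -> dec (uv v).
Proof.
elim=> {v} [v tv|v [l [lnil [nd hl]]] _ IH].
  by rewrite -mon_uv -[mon _ _ _]addr0; apply: (@decS v) => //; constructor.
rewrite (uck2 r K lnil nd hl).
have {hl} : forall e, List.In e l -> s e = v by move=> e /hl.
elim: l {lnil nd} => [|e l IHl] hl; first by rewrite big_nil; constructor.
rewrite big_cons; apply: decD; last by apply: IHl => f fl; apply: hl; right.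
have se : s e = v by apply: hl; left.
rewrite -uer -mulrA.
elim: (IH e se) => [|v' p t x hp ht _ IHx]; first by rewrite mul0r mulr0; constructor.
rewrite mulrDl mulrDr; have [ev|nev] := pselect (r e = v'); last first.
  suff -> : ue e * (mon p t p * us e) = 0 by rewrite add0r.
  have [[//]|[_ h]] := uv_mon_l K (r e) p hp.
  by rewrite -uer -mulrA (mulrA (uv _)) h mul0r mulr0.
have -> : ue e * (mon p t p * us e) = mon (e :: p) t (e :: p).
  by rewrite /mon pth_cons gst_cons !mulrA.
by apply: (@decS (s e)) => //=; split=> //; rewrite ev.
Qed.

Lemma line_prefix t p q w w' : line t -> walk t p w -> walk t q w' ->
  (size p <= size q)%N -> exists u, q = p ++ u.
Proof.
move=> lt; elim: p t q lt => [|e p IH] t q lt /=; first by move=> *; exists q.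
case: q => [|f q] //= [se h1] [sf h2]; rewrite ltnS => h.
have ef : e = f by apply: (lt [::] t).
subst f; have [|u ->] := IH (r e) q _ h1 h2 h; last by exists u.
by move=> l w0 g g' hl; apply: (lt (e :: l)).
Qed.

Lemma line_eq t p q w w' : line t -> walk t p w -> walk t q w' ->
  size p = size q -> p = q.
Proof.
move=> lt h1 h2 sz; have [|u hu] := line_prefix lt h1 h2; first by rewrite sz.
have := congr1 size hu; rewrite size_cat sz => /eqP.
by rewrite -[X in X == _]addn0 eqn_add2l eq_sym => /nilP u0; rewrite hu u0 cats0.
Qed.

Lemma line_walk t p w : line t -> walk t p w -> line w.
Proof.
move=> lt hp q w' e f hq; apply: (lt (p ++ q)).
by apply/walk_cat; exists w.
Qed.

(** At a vertex with a single outgoing edge the sum in [uck2] has one term, so edges along a line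
    are invertible on both sides. *)
Lemma line_mon t p w : line t -> walk t p w -> mon p w p = uv t.
Proof.
elim: p t => [|e p IH] t lt /=; first by move=> ->; rewrite mon_uv.
move=> [se hp].
have le : line (r e) by move=> l w0 g g' hl; apply: (lt (e :: l)).
rewrite /mon pth_cons gst_cons -!mulrA (mulrA (pth p)) (mulrA (pth p * _)).
have := IH _ le hp; rewrite /mon => ->; rewrite mulrA uer.
rewrite (@uck2 _ _ s r K t [:: e]) ?big_seq1 //; first by constructor => //; constructor.
move=> f; split=> [sf|[<-|[]]//]; left; exact: (lt [::] t).
Qed.

Lemma mon_ext t' p w q u w' : line t' -> walk t' p w -> walk w u w' ->
  mon p w q = mon (p ++ u) w' (q ++ u).
Proof.
move=> lt hp hu; rewrite /mon -(line_mon (line_walk lt hp) hu) /mon.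
by rewrite pth_cat gst_cat !mulrA.
Qed.

Lemma mon_inv t' p w q t : line t -> walk t p w -> walk t' q w -> mon p w q * mon q w p = uv t.
Proof.
move=> lt hp hq; rewrite -(line_mon lt hp) /mon -!mulrA.
have e z : uv w * (gst q * (pth q * z)) = uv w * z by rewrite !mulrA (gst_pth' K hq).
by rewrite e (mulrA (uv w)) uvv.
Qed.

(** By [mon_ext] the monomial with the shorter left path is prolonged until the left paths agree.
    The right paths then have equal length by the degree, or else differ by a closed walk, which
    [term1] excludes. *)
Lemma mon_eq t t' p w q p' w' q' : line t -> line t' ->
  walk t p w -> walk t' q w -> walk t p' w' -> walk t' q' w' ->
  mdeg p q = mdeg p' q' \/ term1 s r t -> mon p w q = mon p' w' q'.
Proof.
move=> lt lt'; wlog sz : p w q p' w' q' / (size p <= size p')%N => [hw|].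
  move=> h1 h2 h3 h4 h; case/orP: (leq_total (size p) (size p')) => sz; first exact: hw.
  by apply/esym/hw => //; case: h => h; [left|right].
move=> h1 h2 h3 h4 h; have [u eu] := line_prefix lt h1 h3 sz; subst p'.
have /walk_cat[w2 h31 h32] := h3; have ew := walk_inj h31 h1; subst w2.
rewrite (mon_ext q lt h1 h32); congr (mon _ _ _).
have h2' : walk t' (q ++ u) w' by apply/walk_cat; exists w.
apply: (line_eq lt' h2' h4); case: h => [|[_ h]].
  by rewrite /mdeg !size_cat; lia.
have aux l : walk w' l w' -> l = [::].
  move=> hl; have h5 : walk t ((p ++ u) ++ l) w' by apply/walk_cat; exists w'.
  have := h _ _ _ h3 h5; rewrite !size_cat => hh; apply/nilP; rewrite /nilp; lia.
case/orP: (leq_total (size (q ++ u)) (size q')) => sz'.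
  have [l el] := line_prefix lt' h2' h4 sz'; move: h4; rewrite el => /walk_cat[w2 h5].
  by have -> := walk_inj h5 h2' => /aux ->; rewrite cats0.
have [l el] := line_prefix lt' h4 h2' sz'; move: h2'; rewrite el => /walk_cat[w2 h5].
by have -> := walk_inj h5 h4 => /aux ->; rewrite cats0.
Qed.

(** By [mon_eq] all admissible monomials of the corner coincide, so it is at most
    one-dimensional. *)
Lemma corner_mon (D : int -> Prop) t t' x : line t -> line t' ->
  (forall a b, D a -> D b -> a = b) \/ term1 s r t ->
  spn (CMon s r D t t') x ->
  x = 0 \/ exists k p w q, [/\ CMon s r D t t' p w q, k <> 0 & x = k *: mon p w q].
Proof.
move=> lt lt' hD; elim=> [|k p w q y hc _ IH]; first by left.
have [k0|/eqP k0] := eqVneq k 0; first by rewrite k0 scale0r add0r.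
case: IH => [->|[k' [p' [w' [q' [hc' k'0 ->]]]]]].
  by right; exists k, p, w, q; rewrite addr0.
have -> : mon p' w' q' = mon p w q.
  case: hc hc' => [h1 h2 h3] [h4 h5 h6]; apply: (mon_eq lt lt') => //.
  by case: hD => h; [left; apply: h|right].
rewrite -scalerDl; have [->|/eqP kk] := eqVneq (k + k') 0; first by left; rewrite scale0r.
by right; exists (k + k'), p, w, q.
Qed.

Lemma dec_neq0 u x : dec u -> x * u <> 0 ->
  exists v p t, [/\ walk v p t, term t & x * pth p * uv t <> 0].
Proof.
elim=> [|v p t y hp ht _ IH]; first by rewrite mulr0.
have [e0|ne] := pselect (x * pth p * uv t = 0); last by exists v, p, t.
by rewrite mulrDr /mon !mulrA e0 mul0r add0r.
Qed.

Lemma term_line t : term t -> line t.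
Proof. by case=> [[]|[c []]]. Qed.

Lemma corner_shift (D : int -> Prop) v t p t' x : spn (Mon s r D) x -> uv t * x = x ->
  walk v p t' ->
  spn (CMon s r (fun m => D (m - (size p)%:Z)) t t') (x * pth p * uv t').
Proof.
move=> hx tx hp.
have -> : x * pth p * uv t' = uv t * (x * mon p t' [::]) * uv t'.
  by rewrite /mon gst_nil mulr1 !mulrA tx -(mulrA _ (uv t') (uv t')) uvv.
have hm : spn (Mon s r (eq (size p)%:Z)) (mon p t' [::]).
  by apply: spn_mon; split; [exists v|exists t'|rewrite /mdeg subr0].
by apply: spn_corner; apply: spn_mul hx hm => a b da <-; rewrite addrK.
Qed.

(** Some component of [x] at a terminal vertex is nonzero, hence by [corner_mon] a nonzero scalar
    times an invertible monomial. The opposite degree of [z] will keep idempotents in degree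
    zero. *)
Lemma row_inv (D : int -> Prop) t u x : term t ->
  (forall a b, D a -> D b -> a = b) \/ term1 s r t ->
  spn (Mon s r D) x -> uv t * x = x -> dec u -> x * u = x -> x <> 0 ->
  exists z, [/\ x * z = uv t, z * uv t = z & spn (Mon s r (fun m => D (- m))) z].
Proof.
move=> tt hD hx tx du xu x0.
have [|v [p [t' [hp tt' y0]]]] := @dec_neq0 u x du; first by rewrite xu.
have hy := corner_shift hx tx hp.
have [|//|[k [P [W [Q [[h1 h2 h3] k0 ey]]]]]] := corner_mon (term_line tt) (term_line tt') _ hy.
  by case: hD => h; [left=> a b da db; have := h _ _ da db; lia|right].
exists (k^-1 *: (mon p t' [::] * mon Q W P)).
have e1 : x * mon p t' [::] = k *: mon P W Q.
  by rewrite -ey /mon gst_nil mulr1 mulrA.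
have e2 : mon Q W P * uv t = mon Q W P.
  by have [[_ ->]|[]//] := uv_mon_r K t Q h1.
split.
- rewrite -scalerAr mulrA e1 -scalerAl scalerA mulVf ?scale1r; last exact/eqP.
  exact: (mon_inv (term_line tt) h1 h2).
- by rewrite -scalerAl -mulrA e2.
apply: spnZ; apply: (@spn_mul _ _ _ _ _ (eq (size p)%:Z) (eq (mdeg Q P))).
- by move=> a b <- <-; move: h3; rewrite /mdeg; congr D; lia.
- by apply: spn_mon; split; [exists v|exists t'|rewrite /mdeg subr0].
by apply: spn_mon; split; [exists t'|exists t|].
Qed.

(** * Rows over a positive definite field *)

Section Positive.
Variable conj : K -> K.
Hypothesis conjP : field_involution conj.
Hypothesis pos : positive_definite conj.
Local Notation star := (ustar conj).

(** Inserting the decomposition of [u] writes [x x^*] as a sum of terms [k * conj k] times [t], one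
    for each nonzero component of [x]. Positive definiteness prevents cancellation. *)
Lemma row_star n t u x : term t -> spn (Mon s r (eq n)) x -> uv t * x = x ->
  dec u -> x * u = x -> x <> 0 ->
  exists k, [/\ k <> 0, conj k = k & x * star x = k *: uv t].
Proof.
move=> tt hx tx du xu x0.
have [l [hl1 hl2]] : exists l : seq K,
    x * u * star x = (\sum_(k <- l) k * conj k) *: uv t /\
    (all (fun k => k == 0) l -> x * u = 0).
  elim: du {xu} => [|v p t' y hp tt' _ [l [IH1 IH2]]].
    by exists [::]; rewrite big_nil mulr0 mul0r scale0r.
  have hy := corner_shift hx tx hp.
  have e1 : x * mon p t' p = x * pth p * uv t' * gst p by rewrite /mon !mulrA.
  have e2 : x * mon p t' p * star x = (x * pth p * uv t') * star (x * pth p * uv t').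
    by rewrite !ustarM // ustar_uv // ustar_pth // e1 !mulrA -(mulrA _ (uv t') (uv t')) uvv.
  have [|h0|[k [P [W [Q [[h1 h2 _] k0 ey]]]]]] := corner_mon (term_line tt) (term_line tt') _ hy.
  - by left=> a b /eqP + /eqP; lia.
  - by exists l; rewrite mulrDr mulrDl e2 e1 h0 !mul0r !add0r.
  exists (k :: l); split=> [|/= /andP[/eqP //]].
  rewrite mulrDr mulrDl IH1 e2 ey ustarZ // ustar_mon // big_cons scalerDl; congr (_ + _).
  by rewrite -scalerAl -scalerAr scalerA (mon_inv (term_line tt) h1 h2).
rewrite xu in hl1 hl2.
exists (\sum_(k <- l) k * conj k); split=> //.
  by move=> /pos /hl2.
elim: l {hl1 hl2} => [|k l IH]; first by rewrite big_nil conj0.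
by rewrite big_cons conjD // IH conjM // conjK // mulrC.
Qed.
End Positive.
End Terminal.

(** * Rows over a cyclic vertex *)

Section CyclicVertex.
Variables (V : choiceType) (Ed : Type) (s r : Ed -> V) (K : fieldType).
Local Notation U := (ulpa s r K).
Local Notation uv := (uv s r K).
Local Notation pth := (pth s r K).
Local Notation gst := (gst s r K).
Local Notation mon := (mon s r K).
Local Notation walk := (walk s r).
Variables (t : V) (c : seq Ed).
Hypothesis tc : term2 s r t c.
Implicit Types (x y z : U) (P Q R : {poly K}).

Let lt : line s r t. Proof. by case: tc. Qed.
Let cw : walk t c t. Proof. by case: tc. Qed.
Let C : U := pth c * uv t.
(** The value of [P] at the cycle [c] inside [t A t]; the factor [uv t] is there because
    [horner_alg] sends constants to multiples of the [1] of the unitization. *)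
Definition pol P : U := uv t * horner_alg C P.

Lemma tC : uv t * C = C.
Proof. by rewrite /C mulrA (uv_pth K cw) -mulrA uvv. Qed.
Lemma Ct : C * uv t = C. Proof. by rewrite /C -mulrA uvv. Qed.
Lemma tCC P : uv t * horner_alg C P = horner_alg C P * uv t.
Proof.
elim/poly_ind: P => [|P k IH]; first by rewrite rmorph0 mulr0 mul0r.
rewrite rmorphD rmorphM /= horner_algX horner_algC mulrDr mulrDl mulrA IH.
by rewrite -(mulrA _ (uv t) C) tC -(mulrA _ C) Ct -scalerAl -scalerAr mulr1 mul1r.
Qed.

Lemma polM P Q : pol (P * Q) = pol P * pol Q.
Proof. by rewrite /pol rmorphM /= [RHS]mulrA -(mulrA (uv t) _ (uv t)) -tCC mulrA uvv -mulrA. Qed.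
Lemma polB P Q : pol (P - Q) = pol P - pol Q.
Proof. by rewrite /pol rmorphB mulrBr. Qed.
Lemma polD P Q : pol (P + Q) = pol P + pol Q.
Proof. by rewrite /pol rmorphD mulrDr. Qed.
Lemma polZ k P : pol (k *: P) = k *: pol P.
Proof. by rewrite /pol -mul_polyC rmorphM /= horner_algC mulrA -scalerAr mulr1 scalerAl. Qed.
Lemma pol0 : pol 0 = 0. Proof. by rewrite /pol rmorph0 mulr0. Qed.
Lemma pol_t P : pol P * uv t = pol P.
Proof. by rewrite /pol -mulrA -tCC mulrA uvv. Qed.
Lemma t_pol P : uv t * pol P = pol P.
Proof. by rewrite /pol mulrA uvv. Qed.
Lemma polX n : pol 'X^n = uv t * C ^+ n.
Proof. by rewrite /pol rmorphXn /= horner_algX. Qed.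

Lemma polX1 : pol 'X = C. Proof. by rewrite /pol horner_algX tC. Qed.
Lemma C_pth l : walk t l t -> C * (pth l * uv t) = pth (c ++ l) * uv t.
Proof. by move=> hl; rewrite /C pth_cat -mulrA (mulrA (uv t)) (uv_pth K hl) -!mulrA uvv. Qed.

Lemma power_walk n : exists l, [/\ walk t l t, pth l * uv t = pol 'X^n & size l = (n * size c)%N].
Proof.
elim: n => [|n [l [h1 h2 h3]]].
  by exists [::]; rewrite polX expr0 pth_nil mulr1 mul1r.
exists (c ++ l); split; first by apply/walk_cat; exists t.
  by rewrite exprS polM -h2 polX1 C_pth.
by rewrite size_cat h3 mulSn.
Qed.

(** The minimality of [c] and [line_prefix] allow one copy of [c] to be split off a nonempty closed
    walk. *)
Lemma closed_power l : walk t l t -> exists n, pth l * uv t = pol 'X^n.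
Proof.
have [n] := ubnP (size l); elim: n l => // n IH l ln hl.
have [->|lnil] := pselect (l = [::]); first by exists 0%N; rewrite polX expr0 pth_nil mulr1 mul1r.
have [_ cnil _ cmin] := tc.
have [l' el] := line_prefix lt cw hl (cmin l lnil hl).
move: hl; rewrite el => /walk_cat[w h1 h2]; have ew := walk_inj h1 cw; subst w.
have [|m hm] := IH l' _ h2.
  by move: ln; rewrite el size_cat; case: c cnil => //= *; lia.
by exists m.+1; rewrite exprS polM -hm polX1 C_pth.
Qed.

Lemma pol_mon_inv n : exists z, pol 'X^n * z = uv t.
Proof.
have [l [hl <- _]] := power_walk n; exists (gst l).
exact: (line_mon K lt hl).
Qed.

Lemma reach_back p w : walk t p w -> exists u, walk w u t.
Proof.
move=> hp; have [l [hl _ sl]] := power_walk (size p).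
have c0 : (0 < size c)%N by have [_ + _ _] := tc; case: (c).
have [|u eu] := line_prefix lt hp hl; first by rewrite sl; nia.
by move: hl; rewrite eu => /walk_cat[w' h1 hu]; exists u; rewrite -(walk_inj h1 hp).
Qed.

(** Elements of [t A t] are Laurent polynomials in [c]; they are handled as polynomials after
    clearing denominators. Each monomial is prolonged until both paths return to [t], and so becomes
    a quotient of two powers of [c]. *)
Lemma corner_pol x : spn (CMon s r anydeg t t) x -> exists N P, x * pol 'X^N = pol P.
Proof.
elim=> [|k p w q z [h1 h2 _] _ [N [P IH]]].
  by exists 0%N, 0; rewrite mul0r pol0.
have [u hu] := reach_back h1.
have hp : walk t (p ++ u) t by apply/walk_cat; exists w.
have hq : walk t (q ++ u) t by apply/walk_cat; exists w.
have [i hi] := closed_power hp; have [j hj] := closed_power hq.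
exists (j + N)%N, (k *: ('X^i * 'X^N) + P * 'X^j).
have e1 : mon p w q * pol 'X^j = pol 'X^i.
  rewrite -hj -hi (mon_ext K q lt h1 hu) /mon -!mulrA (mulrA (gst _)).
  by rewrite (gst_pth K hq) uvv.
rewrite exprD mulrDl polD polZ -scalerAl !polM (mulrA (mon p w q)) e1; congr (_ + _).
by rewrite -IH -mulrA -!polM mulrC.
Qed.

(** The evaluation at [t] reads off the coefficient of index [i] after left multiplication by the
    ghost of [c] to the power [i]: the other powers land in nonzero degrees because [c] is not
    empty. *)
Lemma pol_inj P : pol P = 0 -> P = 0.
Proof.
move=> P0; apply/polyP => i; rewrite coef0.
have [ev [evD evZ ev1 evdeg]] := exists_eval s r K t.
have ev0 : ev 0 = 0 by rewrite -(scale0r 0) evZ mul0r.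
have c0 : (0 < size c)%N by have [_ + _ _] := tc; case: (c).
have [li [hli ei si]] := power_walk i.
have eX j : ev (uv t * gst li * pol 'X^j) = (j == i)%:R.
  have [->|ne] := eqVneq j i; first by rewrite -ei mulrA (gst_pth' K hli) uvv.
  have [lj [hlj <- sj]] := power_walk j.
  apply: (evdeg (mdeg [::] li + mdeg lj [::])).
    apply: (@spn_mul _ _ _ _ _ (eq (mdeg [::] li)) (eq (mdeg lj [::]))).
    - by move=> a b <- <-.
    - rewrite -[uv t]mul1r -pth_nil; apply: spn_mon; split=> //; last by exists t.
      by exists t.
    - rewrite -[X in spn _ X]mulr1 -gst_nil; apply: spn_mon; split=> //; first by exists t.
      by exists t.
  by rewrite /mdeg /= si sj; move/eqP: ne; nia.
have : ev (uv t * gst li * pol P) = P`_i.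
  rewrite -[P in LHS]coefK poly_def.
  have -> : forall n, ev (uv t * gst li * pol (\sum_(j < n) P`_j *: 'X^j)) =
     \sum_(j < n) P`_j * (j == i :> nat)%:R.
    elim=> [|n IH]; first by rewrite !big_ord0 pol0 mulr0.
    by rewrite !big_ord_recr /= polD mulrDr evD IH polZ -scalerAr evZ eX.
  have [ip|ip] := ltnP i (size P).
    rewrite (bigD1 (Ordinal ip)) //= eqxx mulr1 big1 ?addr0 // => j /eqP nj.
    have -> : (j == i :> nat) = false by apply/eqP => h; apply: nj; apply: val_inj.
    by rewrite mulr0.
  rewrite nth_default // big1 // => j _.
  have -> : (j == i :> nat) = false by apply/eqP; have := ltn_ord j; lia.
  by rewrite mulr0.
by rewrite P0 mulr0 ev0.
Qed.

(** An invertible monomial [m'] carries the component of [x] at [t'] into [t A t], where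
    [corner_pol] applies. Since only invertible factors are used, [R] is nonzero. *)
Lemma row_pol v p t' x : mem_lpa x -> uv t * x = x -> walk v p t' -> term s r t' ->
  x * pth p * uv t' <> 0 ->
  exists m m' N R, [/\ m' * m = uv t', m' * uv t = m',
    x * pth p * uv t' * m' * pol 'X^N = pol R & R <> 0].
Proof.
move=> mx tx hp tt' y0; have [T ex] := memP mx.
have sx : spn (Mon s r anydeg) x by rewrite ex; apply: spn_inj.
have hy := corner_shift sx tx hp.
(* A nonzero element has some monomial in its expansion, and this one links [t] with [t']. *)
have [Pm [W [Qm [h1 h2]]]] : exists Pm W Qm, walk t Pm W /\ walk t' Qm W.
  by case: hy y0 => // k Pm W Qm z [h1 h2 _] _ _; exists Pm, W, Qm.
have e1 := mon_inv K (term_line tt') h2 h1.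
have e2 : mon Qm W Pm * uv t = mon Qm W Pm by have [[_ ->]|[]//] := uv_mon_r K t Qm h1.
have [N [R eR]] : exists N P, (x * pth p * uv t' * mon Qm W Pm) * pol 'X^N = pol P.
  apply: corner_pol; rewrite -[X in spn _ X]mulrA -e2.
  have -> : x * pth p * (uv t' * (mon Qm W Pm * uv t)) =
    uv t * (x * pth p * uv t' * mon Qm W Pm) * uv t by rewrite !mulrA tx.
  apply: spn_corner; apply: (@spn_mul _ _ _ _ _ anydeg anydeg) => //.
    by apply: spn_sub hy => a b d [? ? _]; split=> //; [exists t|exists t'].
  by apply: spn_mon; split=> //; [exists t'|exists t].
exists (mon Pm W Qm), (mon Qm W Pm), N, R; split=> // R0; apply: y0.
have [z hz] := pol_mon_inv N.
have h0 : x * pth p * uv t' * mon Qm W Pm = 0.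
  rewrite -e2 -hz (mulrA (mon _ _ _) (pol _)) (mulrA _ (mon _ _ _ * _)).
  by rewrite (mulrA _ (mon _ _ _) (pol _)) eR R0 pol0 mul0r.
transitivity (x * pth p * uv t' * (mon Qm W Pm * mon Pm W Qm)).
  by rewrite e1 -[RHS]mulrA uvv.
by rewrite mulrA h0 mul0r.
Qed.

Hypothesis all_good : forall v, good s r v.

Lemma vsum_dec F : dec (vsum s r K F).
Proof.
rewrite /vsum; elim: F => [|v F IH]; first by rewrite big_nil; constructor.
by rewrite big_cons; apply: decD => //; apply: good_dec.
Qed.

Lemma mem_row x : uv t * x = x -> mem_lpa x.
Proof. by move=> <-; apply: memMl. Qed.

(** A nonzero [y] would have a component given by a nonzero polynomial [R], and [{poly K}] has no
    zero divisors. *)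
Lemma pol_cancel Q y : Q <> 0 -> uv t * y = y -> pol Q * y = 0 -> y = 0.
Proof.
move=> Q0 ty Qy; have my := mem_row ty; apply: contrapT => y0.
have [F [_ _ yF _ _]] := local_unit2 my my.
have [|v [p [t' [hp tt' yn]]]] := @dec_neq0 _ _ _ _ _ _ y (vsum_dec F); first by rewrite yF.
have [m [m' [N [R [_ _ eR R0]]]]] := row_pol my ty hp tt' yn.
have /pol_inj/eqP : pol (Q * R) = 0 by rewrite polM -eR !mulrA Qy !mul0r.
by rewrite mulf_eq0 => /orP[] /eqP.
Qed.

(* The ideal [x A t] of the Laurent polynomial ring [t A t] is principal. *)
Lemma row_gen u x : mem_lpa x -> uv t * x = x -> dec u -> x * u = x -> x <> 0 ->
  exists Q z w, [/\ Q <> 0, x * z = pol Q, z * uv t = z, x = pol Q * w & uv t * w = w].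
Proof.
move=> mx tx du xu x0.
(* [J] is the set of polynomials in [x A t]. A nonzero member [Q] of least size divides the others
   by Euclidean division ([Qdvd]). *)
pose J P := exists z, x * z = pol P /\ z * uv t = z.
(* Each nonzero component of [x] is a left multiple by some member of [J]: the invertible factors
   supplied by [row_pol] are moved to the other side. *)
have JR v p t' : walk v p t' -> term s r t' -> x * pth p * uv t' <> 0 ->
    exists m N R, [/\ J R, R <> 0 & x * pth p * uv t' = pol R * (gst N * m)].
  move=> hp tt' y0; have [m [m' [N [R [e1 e2 eR R0]]]]] := row_pol mx tx hp tt' y0.
  have [l [hl el _]] := power_walk N.
  exists m, l, R; split=> //.
    exists (pth p * uv t' * m' * pol 'X^N); split; first by rewrite -eR !mulrA.
    by rewrite -mulrA pol_t.
  have e3 : pol 'X^N * (gst l * m) = uv t * m.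
    by rewrite -el mulrA; congr (_ * _); apply: (line_mon K lt hl).
  rewrite -eR -[RHS]mulrA e3 -[RHS]mulrA (mulrA m') e2 e1.
  by rewrite -[RHS]mulrA uvv.
have [Q [JQ Q0 Qmin]] : exists Q, [/\ J Q, Q <> 0 & forall P, J P -> P <> 0 -> (size Q <= size P)%N].
  have [|v [p [t' [hp tt' y0]]]] := @dec_neq0 _ _ _ _ _ _ x du; first by rewrite xu.
  have [_ [_ [R [JR' R0 _]]]] := JR _ _ _ hp tt' y0.
  have [n] := ubnP (size R); elim: n R JR' R0 => // n IH R JR' R0 Rn.
  have [[P [h1 h2 h3]]|h] := pselect (exists P, [/\ J P, P <> 0 & (size P < size R)%N]).
    by apply: (IH P) => //; lia.
  exists R; split=> // P h1 h2; rewrite leqNgt; apply/negP => h3; apply: h.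
  by exists P.
have [z0 [hz0 hz0t]] := JQ.
have Qdvd P : J P -> P = Q * (P %/ Q).
  move=> [z [hz hzt]]; have : J (P %% Q).
    exists (z - z0 * pol (P %/ Q)); split.
      rewrite mulrBr mulrA hz hz0 -polM -polB; congr pol.
      by rewrite {1}(divp_eq P Q) [Q * _]mulrC addrAC subrr add0r.
    by rewrite mulrBl hzt -mulrA pol_t.
  move=> JP; have [P0|/eqP P0] := eqVneq (P %% Q) 0.
    by rewrite {1}(divp_eq P Q) P0 addr0 mulrC.
  by have := Qmin _ JP P0; rewrite leqNgt ltn_modp (introN eqP Q0).
(* The factor [w] is assembled component by component along the decomposition of [u]. *)
suff [w [hw htw]] : exists w, x * u = pol Q * w /\ uv t * w = w.
  by exists Q, z0, w; split=> //; rewrite -hw xu.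
elim: du {xu} => [|v p t' y hp tt' _ [w [IH1 IH2]]].
  by exists 0; rewrite !mulr0.
have [y0|y0] := pselect (x * pth p * uv t' = 0).
  by exists w; rewrite mulrDr /mon !mulrA y0 mul0r add0r.
have [m [N [R [JR' R0 eR]]]] := JR _ _ _ hp tt' y0.
exists (pol (R %/ Q) * (gst N * m * gst p) + w); split; last first.
  by rewrite mulrDr IH2 mulrA t_pol.
have e : x * mon p t' p = pol R * (gst N * m * gst p).
  have -> : x * mon p t' p = x * pth p * uv t' * gst p by rewrite /mon !mulrA.
  by rewrite eR -[LHS]mulrA.
by rewrite mulrDr IH1 e mulrDr (mulrA (pol Q)) -polM -Qdvd.
Qed.
End CyclicVertex.

(** * Rank and descent *)

HB.instance Definition _ (V Ed : Type) := gen_eqMixin (point V Ed).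

Section FinitePoints.
Variables (V Ed : Type) (s r : Ed -> V).
Local Notation pt := (point V Ed).

(** On a line the current vertex forces the next step: its only edge if it emits one, a stop
    otherwise. *)
Lemma line_point t (x y : pt) : line s r t -> boundary s r x -> boundary s r y ->
  src x = t -> src y = t -> x = y.
Proof.
move=> lt bx by_ sx sy.
have same w o o' : line s r w ->
    match o with Some e => s e = w | None => ~ regular s w end ->
    match o' with Some e => s e = w | None => ~ regular s w end -> o = o'.
  move=> lw; have reg e : s e = w -> regular s w.
    move=> se; exists [:: e]; split=> //; split; first by constructor=> //; constructor.
    move=> f; split=> [sf|[<-//|[]]]; left; exact: (lw [::] w).
  case: o o' => [e|] [f|] //; first by move=> se sf; congr Some; apply: (lw [::] w).
    by move=> /reg h /(_ h).
  by move=> h /reg.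
suff h : forall n, x n = y n /\ exists p, walk s r t p (x n).1.
  by apply/funext => n; case: (h n).
have st (z : pt) n : boundary s r z ->
    match (z n).2 with Some e => s e = (z n).1 | None => ~ regular s (z n).1 end.
  by move=> /(_ n); case: (z n) => w [e|] [].
have ext n : (x n).1 = (y n).1 -> (exists p, walk s r t p (x n).1) -> x n = y n.
  move=> e [p hp]; have hx := st x n bx; have hy := st y n by_.
  rewrite -e in hy; have := same _ _ _ (line_walk lt hp) hx hy.
  by move: e; case: (x n) (y n) => [? ?] [? ?] /= -> ->.
elim=> [|n [IH [p hp]]].
  suff e : exists p, walk s r t p (x 0%N).1 by split=> //; apply: ext => //; rewrite -/(src x) sx.
  by exists [::].
have [e1 e2] : (x n.+1).1 = (y n.+1).1 /\ exists p, walk s r t p (x n.+1).1.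
  have := bx n; have := by_ n; rewrite -IH; case: (x n) hp => w [e|] /= hp.
    move=> [se ->] [_ ->]; split=> //; exists (rcons p e).
    by apply/walk_rcons; rewrite se.
  by move=> [_ ->] [_ ->]; split=> //; exists p.
by split=> //; apply: ext.
Qed.

Lemma good_points v : good s r v ->
  exists l : seq pt, forall x, boundary s r x -> src x = v -> List.In x l.
Proof.
elim=> {v} [t tt|v [l [lnil [nd hl]]] _ IH].
  have [x0 bx0 sx0] := exists_boundary s r t; exists [:: x0] => x bx sx.
  by left; apply: line_point (term_line tt) bx0 bx sx0 sx.
have [L hL] : exists L : seq pt, forall e x, List.In e l -> boundary s r x ->
    x 0%N = (s e, Some e) -> List.In x L.
  have : forall e, List.In e l -> s e = v by move=> e /hl.
  elim: l {lnil nd hl} => [|e l IHl] hl; first by exists [::].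
  have [|L hL] := IHl _; first by move=> f fl; apply: hl; right.
  have [L' hL'] := IH e (hl e (or_introl erefl)).
  exists (List.map (pcons s e) L' ++ L) => f x [<-|fl] bx hx; apply: List.in_or_app; last first.
    by right; apply: hL fl bx hx.
  left; rewrite -(pcons_tail hx); apply: List.in_map; apply: hL'.
    exact: boundary_tail.
  exact: src_tail bx hx.
exists L => x bx sx; have := bx 0%N; move: sx; rewrite /src.
case E : (x 0%N) => [w [e|]] /= ew; subst w => -[].
  by move=> se _; apply: (hL e) => //; [apply/hl|rewrite E se].
by move=> []; exists l.
Qed.
End FinitePoints.

Section Rank.
Variables (V : choiceType) (Ed : Type) (s r : Ed -> V) (K : fieldType).
Hypothesis all_good : forall v, good s r v.
Local Notation U := (ulpa s r K).
Local Notation uv := (uv s r K).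
Local Notation vsum := (vsum s r K).
Local Notation pt := (point V Ed).

Lemma points_of (F : seq V) : exists X : seq pt, uniq X /\
  forall x, (x \in X) <-> boundary s r x /\ src x \in F.
Proof.
have [L hL] : exists L : seq pt, forall x, boundary s r x -> src x \in F -> x \in L.
  elim: F => [|v F [L IH]]; first by exists [::].
  have [L' hL'] := good_points (all_good v); exists (L' ++ L) => x bx.
  rewrite in_cons mem_cat => /orP[/eqP sx|/(IH _ bx) ->]; last by rewrite orbT.
  apply/orP; left; have := hL' x bx sx; elim: L' {hL'} => //= y L' IHL [->|/IHL h].
    by rewrite mem_head.
  by rewrite in_cons h orbT.
exists (undup (filter (fun x => `[< boundary s r x /\ src x \in F >]) L)).
split=> [|x]; first exact: undup_uniq.
rewrite mem_undup mem_filter; split=> [/andP[/asboolP]//|[bx sx]].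
by apply/andP; split; [apply/asboolP|apply: hL].
Qed.

(** Functions of the boundary path alone; for [d = 0] they are stable, and those supported on the
    finite list [X] have the functions [delta] as a basis. *)
Definition slice (phi : Fn V Ed K) := forall x n, phi x n = phi x 0.

Lemma rho_slice (a : lterm V Ed K) phi : slice phi -> slice (rho s r 0 a phi).
Proof.
elim: a phi => [v|e|e||a IHa b IHb|k a IHa|a IHa b IHb] phi h x n //=.
- by case: ifP => // _; rewrite h.
- by case: ifP => // _; rewrite h [RHS]h.
- by case: ifP => // _; rewrite h [RHS]h.
- by rewrite (IHa _ h) (IHb _ h).
- by rewrite (IHa _ h).
- by apply: IHa; apply: IHb.
Qed.
Lemma urho_slice (a : U) phi : slice phi -> slice (urho 0 a phi).
Proof. by move=> h x n; rewrite /urho h (rho_slice _ h). Qed.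

Variables (F : seq V) (X : seq pt).
Hypothesis uF : uniq F.
Hypothesis uX : uniq X.
Hypothesis hX : forall x, (x \in X) <-> boundary s r x /\ src x \in F.

Lemma urho_vsum phi x n : urho 0 (vsum F) phi x n = if x \in X then phi x n else 0.
Proof.
have aux : urho 0 (vsum F) phi x n = \sum_(v <- F) (if `[< boundary s r x /\ src x = v >] then phi x n else 0).
  rewrite /vsum; elim: F => [|v l IH]; first by rewrite !big_nil urho0.
  by rewrite !big_cons urhoD IH urho_uv.
rewrite aux; case: ifPn => [/hX[bx sF]|nX].
  rewrite (big_rem _ sF) /= asboolT // big1_seq ?addr0 // => v /andP[_].
  rewrite mem_rem_uniq // => /andP[/eqP ne _]; case: asboolP => // -[_ h].
  by case: ne.
rewrite big1_seq // => v /andP[_ vF]; case: asboolP => // -[bx sx].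
by case/negP: nX; apply/hX; rewrite sx.
Qed.

Definition delta (y : pt) : Fn V Ed K := fun x _ => (x == y)%:R.
Lemma delta_slice y : slice (delta y). Proof. by []. Qed.

Lemma slice_decomp phi : slice phi -> (forall x n, x \notin X -> phi x n = 0) ->
  phi = fun x n => \sum_(y <- X) phi y 0 * delta y x n.
Proof.
move=> h0 hz; apply/funext => x; apply/funext => n; rewrite h0.
have [xX|xX] := boolP (x \in X).
  rewrite (big_rem _ xX) /= /delta eqxx mulr1 big1_seq ?addr0 // => y /andP[_].
  by rewrite mem_rem_uniq // => /andP[/negPf ne _]; rewrite eq_sym ne mulr0.
rewrite hz // big1_seq // => y /andP[_ yX]; rewrite /delta.
by case: eqP => [e|_]; [rewrite e yX in xX|rewrite mulr0].
Qed.

Definition rmx (a : U) : 'M[K]_(size X) :=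
  \matrix_(i, j) urho 0 a (delta (tnth (in_tuple X) j)) (tnth (in_tuple X) i) 0.

Lemma urho_supp a phi x n : vsum F * a = a -> x \notin X -> urho 0 a phi x n = 0.
Proof. by move=> <- nX; rewrite urhoM urho_vsum (negPf nX). Qed.

Lemma rmxM a b : vsum F * b = b -> rmx (a * b) = rmx a *m rmx b.
Proof.
move=> ub; apply/matrixP => i j; rewrite !mxE urhoM.
set phi := urho 0 b _.
rewrite (@slice_decomp phi); last first.
- by move=> x n; apply: urho_supp.
- by apply: urho_slice.
rewrite urho_sum big_tnth; apply: eq_bigr => k _.
by rewrite !mxE mulrC.
Qed.
Lemma rmxB a b : rmx (a - b) = rmx a - rmx b.
Proof. by apply/matrixP => i j; rewrite !mxE urhoD -scaleN1r urhoZ mulN1r. Qed.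

Lemma rmx_eq0 a phi x n : vsum F * a = a -> a * vsum F = a -> slice phi -> rmx a = 0 ->
  urho 0 a phi x n = 0.
Proof.
move=> ua au h a0; rewrite -au urhoM.
rewrite (@slice_decomp (urho 0 (vsum F) phi)); last first.
- by move=> y m nX; rewrite urho_vsum (negPf nX).
- exact: urho_slice.
rewrite urho_sum big1_seq // => y /andP[_ yX].
have [xX|xX] := boolP (x \in X); last by rewrite (@urho_supp a) // mulr0.
rewrite (urho_slice a (@delta_slice y) x).
have [i ->] : exists i, x = tnth (in_tuple X) i by apply/tnthP.
have [j ->] : exists j, y = tnth (in_tuple X) j by apply/tnthP.
by move/matrixP: a0 => /(_ i j); rewrite !mxE => ->; rewrite mulr0.
Qed.

(** Equal ranks would make the matrices of [e] and [g] equal, so [z w] would act as zero. But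
    [t = w (z w) z] acts nontrivially on the constant function [1] at a boundary path from [t]. *)
Lemma rank_lt e g z w t : vsum F * e = e -> e * vsum F = e -> e * e = e ->
  e * g = g -> g * e = g -> g * g = g -> e - g = z * w -> w * z = uv t ->
  (\rank (rmx g) < \rank (rmx e))%N.
Proof.
move=> ue eu ee eg ge gg egzw wz.
have ug : vsum F * g = g by rewrite -eg mulrA ue.
have sub : (rmx g <= rmx e)%MS by rewrite -ge rmxM // submxMl.
rewrite ltn_neqAle mxrankS // andbT; apply/eqP => eqr.
have /submxP[D hD] : (rmx e <= rmx g)%MS.
  by have := mxrank_leqif_sup sub; rewrite /leqif eqr eqxx => -[_ <-].
have e0 : rmx (z * w) = 0.
  rewrite -egzw rmxB; have : rmx e *m rmx g = rmx g by rewrite -rmxM // eg.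
  by rewrite {1}hD -mulmxA -rmxM // gg -hD => ->; rewrite subrr.
have [x bx sx] := exists_boundary s r t.
have : urho 0 (uv t) (fun _ _ => 1 : K) x 0 = 1.
  by rewrite urho_uv asboolT.
have -> : uv t = w * (z * w) * z by rewrite !mulrA wz -mulrA wz uvv.
rewrite [urho 0 (w * (z * w) * z) _]urhoM [urho 0 (w * (z * w)) _]urhoM.
have -> : urho 0 (z * w) (urho 0 z (fun _ _ => 1 : K)) = fun _ _ => 0.
  apply/funext => y; apply/funext => n; apply: rmx_eq0 => //.
  - by rewrite -egzw mulrBr ue ug.
  - by rewrite -egzw mulrBl eu -ge -mulrA eu.
  - exact: urho_slice.
by rewrite urho_zero => /esym/eqP; rewrite oner_eq0.
Qed.
End Rank.

Section Descent.
Variables (V : choiceType) (Ed : Type) (s r : Ed -> V) (K : fieldType).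
Hypothesis all_good : forall v, good s r v.
Local Notation U := (ulpa s r K).
Local Notation uv := (uv s r K).
Local Notation gst := (gst s r K).
Local Notation vsum := (vsum s r K).

(* [Q] is a class of idempotents in which a nonzero row can be split off. *)
Definition splits (Q S : U -> Prop) := forall e x, Q e -> mem_lpa e -> e * e = e ->
  S x -> x * e <> 0 -> exists t z w,
  [/\ w * z = uv t, [/\ e * z = z, w * e = w & uv t * w = w], x * (z * w) = x * e,
      forall y, e * y = y -> x * y = 0 -> w * y = 0 & Q (e - z * w)].

(** Every idempotent produced satisfies [g = e g e], so the vertices [F] and points [X] fixed for
    the initial [e] serve throughout. Once all of [S] kills [e], take [f = e]. *)
Lemma descent Q S e : splits Q S -> Q e -> mem_lpa e -> e * e = e ->
  exists f, [/\ Q f, f * f = f, e * f = f /\ f * e = f, forall x, S x -> x * f = 0 &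
    forall y, e * y = y -> (forall x, S x -> x * y = 0) -> f * y = y].
Proof.
move=> hs Qe me ee.
have [F [uF ue eu _ _]] := local_unit2 me me.
have [X [uX hX]] := points_of all_good F.
have [n] := ubnP (\rank (rmx X e)); elim: n e Qe me ee ue eu => // n IH e Qe me ee ue eu en.
have [[x [Sx xe]]|h] := pselect (exists x, S x /\ x * e <> 0); last first.
  exists e; split=> // x Sx; apply: contrapT => xe; apply: h; exists x.
  by [].
have [t [z [w [wz [ez we tw] xzw hy Qg]]]] := hs _ _ Qe me ee Sx xe.
pose g := e - z * w.
have zwzw : z * w * (z * w) = z * w.
  by rewrite mulrA -(mulrA z) wz -mulrA tw.
have eg : e * g = g by rewrite /g mulrBr ee mulrA ez.
have ge : g * e = g by rewrite /g mulrBl ee -mulrA we.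
have gg : g * g = g.
  by rewrite {1}/g mulrBl eg {1 2}/g mulrBr -(mulrA z w e) we zwzw subrr subr0.
have egg : e - g = z * w by rewrite /g opprB addrCA subrr addr0.
have mg : mem_lpa g by rewrite -eg; apply: memMl.
have rk := @rank_lt _ _ _ _ _ F X uF uX hX e g z w t ue eu ee eg ge gg egg wz.
have ug : vsum F * g = g by rewrite -eg mulrA ue.
have gu : g * vsum F = g by rewrite -ge -mulrA eu.
have [|f [Qf ff [gf fg] fS fy]] := IH g Qg mg gg ug gu; first by apply: leq_trans rk _; lia.
exists f; split=> //.
- by split; [rewrite -gf mulrA eg|rewrite -fg -mulrA ge].
move=> y ey yS; apply: fy => //; rewrite /g mulrBl ey -mulrA hy ?mulr0 ?subr0 //.
exact: yS.
Qed.
End Descent.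

(** * Sufficiency *)

Section Sufficiency.
Variables (V : choiceType) (Ed : Type) (s r : Ed -> V) (K : fieldType) (conj : K -> K).
Hypothesis conjP : field_involution conj.
Hypothesis all_good : forall v, good s r v.
Local Notation T := (lterm V Ed K).
Local Notation U := (ulpa s r K).
Local Notation uv := (uv s r K).
Local Notation gst := (gst s r K).
Local Notation pth := (pth s r K).
Local Notation walk := (walk s r).
Local Notation star := (ustar conj).
Local Notation inj := (inj s r).

Definition rows (S : U -> Prop) y := exists x v p t,
  [/\ S x, walk v p t, term s r t & y = uv t * gst p * x].

(** An element is recovered from its rows: a local unit on its left is a sum of [p p^*], and [x] is
    the sum of the corresponding [p (t p^* x)]. *)
Lemma rows_ann (S : U -> Prop) y : (forall x, S x -> mem_lpa x) ->
  (forall x, rows S x -> x * y = 0) <-> (forall x, S x -> x * y = 0).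
Proof.
move=> mS; split=> h x; last first.
  by move=> [x' [v [p [t [Sx _ _ ->]]]]]; rewrite -mulrA h // mulr0.
move=> Sx; have mx := mS _ Sx; have [F [_ <- _ _ _]] := local_unit2 mx mx.
elim: (vsum_dec K all_good F) => [|v p t z hp tt _ IH]; first by rewrite !mul0r.
rewrite !mulrDl IH addr0 /mon -!mulrA (mulrA (gst p)) (mulrA (uv t)) (mulrA (uv t)).
by rewrite h ?mulr0 //; exists x, v, p, t.
Qed.

Lemma rows_term (S : U -> Prop) x : rows S x ->
  mem_lpa x /\ exists2 t, term s r t & uv t * x = x.
Proof.
move=> [y [v [p [t [_ _ tt ->]]]]]; split; first by rewrite -mulrA; apply: memMl.
by exists t => //; rewrite !mulrA uvv.
Qed.

(** Over an acyclic [t] the row is right invertible and [w = x e] works. Over a cyclic [t] one only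
    has [x e = pol Q * w]; the identities for [w] and [z] that do not follow directly are checked
    after multiplying by [pol Q] and then cancelled. *)
Lemma splits_any S : splits (fun=> True) (rows S).
Proof.
move=> e x _ me ee /rows_term[mx [t tt tx]] xe.
have mxe : mem_lpa (x * e) by apply: memMl.
have [F [_ _ xF _ _]] := local_unit2 mxe mxe.
have du := vsum_dec K all_good F.
have txe : uv t * (x * e) = x * e by rewrite mulrA tx.
case: (tt) => [t1|[c tc]].
  have [X eX] := memP mxe.
  have sx : spn (Mon s r anydeg) (x * e) by rewrite eX; apply: spn_inj.
  have [z [h1 h2 _]] := row_inv tt (or_intror t1) sx txe du xF xe.
  exists t, (e * z), (x * e); split=> //.
  - by rewrite -h1 -!mulrA (mulrA e e) ee.
  - by split=> //; rewrite ?mulrA ?ee // -mulrA ee.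
  - by rewrite !mulrA h1 tx.
  by move=> y ey xy; rewrite -mulrA ey.
have [Q [z [w [Q0 h1 h2 h3 h4]]]] := row_gen tc mxe txe du xF xe.
have we : w * e = w.
  apply/eqP; rewrite -subr_eq0; apply/eqP; apply: (pol_cancel tc all_good Q0).
    by rewrite mulrBr mulrA h4.
  by rewrite mulrBr mulrA -h3 -mulrA ee subrr.
exists t, (e * z), w; split=> //.
- apply/eqP; rewrite -subr_eq0; apply/eqP; apply: (pol_cancel tc all_good Q0).
    by rewrite mulrBr !mulrA h4 uvv.
  by rewrite mulrBr !mulrA -h3 pol_t // -(mulrA x) ee h1 subrr.
- by split=> //; rewrite mulrA ee.
- by rewrite !mulrA h1 -h3.
move=> y ey xy; apply: (pol_cancel tc all_good Q0); first by rewrite mulrA h4.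
by rewrite mulrA -h3 -mulrA ey.
Qed.

Definition homog (x : U) := exists n, spn (Mon s r (eq n)) x.

Lemma spn_row n v p t (x : U) : walk v p t -> spn (Mon s r (eq n)) x ->
  spn (Mon s r (eq (mdeg [::] p + n))) (uv t * gst p * x).
Proof.
move=> hp hn; apply: (@spn_mul _ _ _ _ _ (eq (mdeg [::] p)) (eq n)) => // [a b <- <- //|].
rewrite -[X in X * _]mul1r -pth_nil; apply: spn_mon; split=> //; first by exists t.
by exists v.
Qed.

(** A nonzero row of [x] has a right inverse of degree opposite to the one coming from [n].
    Computing the product with the degree coming from [m] puts [t] in degree [m - n], against its
    evaluation being [1]. *)
Lemma homog_direct n m (x : U) : spn (Mon s r (eq n)) x -> spn (Mon s r (eq m)) x -> n <> m -> x = 0.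
Proof.
move=> hn hm nm; apply: contrapT => x0.
have mS y : y = x -> mem_lpa y by move=> ->; apply: mem_spn; apply: spn_any hn.
(* Used with [1] as the annihilated element, [rows_ann] reduces [x = 0] to the vanishing of its
   rows. *)
apply: x0; rewrite -[x]mulr1; apply: (proj1 (rows_ann 1 mS)) => // y hy.
have [my _] := rows_term hy; rewrite mulr1; move: hy => [_ [v [p [t [-> hp tt ey]]]]].
apply: contrapT => y0; have [F [_ _ yF _ _]] := local_unit2 my my.
have hny : spn (Mon s r (eq (mdeg [::] p + n))) y by rewrite ey; apply: spn_row hp hn.
have hmy : spn (Mon s r (eq (mdeg [::] p + m))) y by rewrite ey; apply: spn_row hp hm.
have ty : uv t * y = y by rewrite ey !mulrA uvv.
have [|z [h1 _ h3]] := row_inv tt _ hny ty (vsum_dec K all_good F) yF y0.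
  by left=> a b <- <-.
have [ev [_ _ ev1 evd]] := exists_eval s r K t.
have : ev (uv t) = 0.
  apply: (evd (m - n)); last lia.
  by rewrite -h1; apply: spn_mul hmy h3 => a b <-; lia.
by rewrite ev1 => /eqP; rewrite oner_eq0.
Qed.

(** An idempotent of degree [n] also has degree [n + n], so it vanishes unless [n = 0]. *)
Lemma homog_idem e : homog e -> e * e = e -> spn (Mon s r (eq 0)) e.
Proof.
move=> [n hn] ee; have [n0|n0] := pselect (n = 0); first by move: hn; rewrite n0.
rewrite (homog_direct (m := n + n) hn _ _); [exact: spn0| |lia].
by rewrite -ee; apply: (spn_mul _ hn hn) => a b <- <-.
Qed.

Lemma rows_homog S x : (forall x, S x -> homog x) -> rows S x -> homog x.
Proof.
move=> hS [y [v [p [t [/hS[n hn] hp _ ->]]]]].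
by exists (mdeg [::] p + n); apply: spn_row hp hn.
Qed.

(** Homogeneity makes [row_inv] available at cyclic vertices too, and [z] has degree [-n]. *)
Lemma splits_graded S : (forall x, S x -> homog x) ->
  splits (fun e => spn (Mon s r (eq 0)) e) (rows S).
Proof.
move=> hS e x he me ee hx xe; have [mx [t tt tx]] := rows_term hx.
have [n hn] := rows_homog hS hx.
have hxe : spn (Mon s r (eq n)) (x * e).
  by apply: spn_mul hn he => a b <- <-; rewrite addr0.
have mxe : mem_lpa (x * e) by apply: memMl.
have [F [_ _ xF _ _]] := local_unit2 mxe mxe.
have du := vsum_dec K all_good F.
have txe : uv t * (x * e) = x * e by rewrite mulrA tx.
have [|z [h1 h2 h3]] := row_inv tt _ hxe txe du xF xe; first by left=> a b <- <-.
exists t, (e * z), (x * e); split=> //.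
- by rewrite -h1 -!mulrA (mulrA e e) ee.
- by split=> //; rewrite ?mulrA ?ee // -mulrA ee.
- by rewrite !mulrA h1 tx.
- by move=> y ey xy; rewrite -mulrA ey.
apply: spnB => //; apply: (@spn_mul _ _ _ _ _ (fun m => n = - m) (eq n)) => //.
  by move=> a b h <-; lia.
by apply: spn_mul he h3 => a b <- h; lia.
Qed.

(** With [z] a multiple of the adjoint of [w = x e] by the inverse of the self-conjugate scalar of
    [row_star], the idempotent [z w] is self-adjoint. *)
Lemma splits_star S : positive_definite conj -> (forall x, S x -> homog x) ->
  splits (fun e => spn (Mon s r (eq 0)) e /\ star e = e) (rows S).
Proof.
move=> pos hS e x [he se] me ee hx xe; have [mx [t tt tx]] := rows_term hx.
have [n hn] := rows_homog hS hx.
have hxe : spn (Mon s r (eq n)) (x * e).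
  by apply: spn_mul hn he => a b <- <-; rewrite addr0.
have mxe : mem_lpa (x * e) by apply: memMl.
have [F [_ _ xF _ _]] := local_unit2 mxe mxe.
have du := vsum_dec K all_good F.
have txe : uv t * (x * e) = x * e by rewrite mulrA tx.
have [k [k0 ck hk]] := row_star conjP pos tt hxe txe du xF xe.
have ck' : conj k^-1 = k^-1.
  have kk : k^-1 * k = 1 by rewrite mulVf //; apply/eqP.
  apply: (@mulIf _ k); first exact/eqP.
  by rewrite kk -{2}ck -conjM // kk conj1.
have esx : e * star (x * e) = star (x * e) by rewrite ustarM // se mulrA ee.
exists t, (k^-1 *: star (x * e)), (x * e).
have inv : x * e * (k^-1 *: star (x * e)) = uv t.
  by rewrite -scalerAr hk scalerA mulVf ?scale1r //; apply/eqP.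
split=> //.
- by split=> //; [rewrite -scalerAr esx|rewrite -mulrA ee].
- have e1 : x * (k^-1 *: star (x * e)) = uv t by rewrite -[in LHS]esx scalerAr mulrA.
  by rewrite mulrA e1 txe.
- by move=> y ey xy; rewrite -mulrA ey.
split; last first.
  by rewrite ustarB // se ustarM // ustarZ // ustarK // ck' -scalerAl -scalerAr.
apply: spnB => //; apply: (@spn_mul _ _ _ _ _ (eq (- n)) (eq n)) => //.
  by move=> a b <- <-; lia.
by apply: spnZ; apply: spn_star.
Qed.

Lemma descent_rows Q S e : (forall x, S x -> mem_lpa x) -> splits Q (rows S) ->
  Q e -> mem_lpa e -> e * e = e ->
  exists f, [/\ Q f, f * f = f, e * f = f /\ f * e = f, forall x, S x -> x * f = 0 &
    forall y, e * y = y -> (forall x, S x -> x * y = 0) -> f * y = y].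
Proof.
move=> mS hs Qe me ee; have [f [h1 h2 h3 h4 h5]] := descent all_good hs Qe me ee.
exists f; split=> //; first exact/rows_ann.
by move=> y ey hy; apply: h5 => //; apply/rows_ann.
Qed.

Lemma corner_transfer (Q : U -> Prop) (S : T -> Prop) (e : T) :
  splits Q (rows (fun u => exists2 x, S x & u = inj x)) ->
  Q (inj e) -> idem s r e ->
  exists f, [/\ Q (inj f), idem s r f, corner s r e f &
    forall y, rann_in s r e S y <-> rgen_in s r e f y].
Proof.
move=> hs Qe /injP; rewrite injM => ee.
have [|fu [Qf ff [ef fe] fS fy]] := @descent_rows Q _ _ _ hs Qe (mem_inj s r e) ee.
  by move=> x [x' _ ->].
have [|f efu] := @memP _ _ _ _ _ fu; first by rewrite -fe; apply: memMr.
subst fu; exists f; split=> //.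
- by apply/injP; rewrite injM.
- by apply/injP; rewrite !injM ef fe.
move=> y; split=> [[/injP cy Sy]|[z [/injP cz /injP yz]]].
  exists y; split; first exact/injP.
  apply/injP; rewrite injM fy //.
    by rewrite cy !injM !mulrA ee.
  move=> _ [x Sx ->]; rewrite -injM -(inj0 s r K); apply/injP; exact: Sy.
rewrite !injM in cz yz; split.
  apply/injP; rewrite !injM yz !mulrA ef -[RHS]mulrA; congr (_ * _).
  by rewrite cz -!mulrA ee.
move=> x Sx; apply/injP; rewrite injM yz mulrA fS ?mul0r //.
by exists x.
Qed.
End Sufficiency.

(** * Transfer to terms *)

Section Transfer.
Variables (V : choiceType) (Ed : Type) (s r : Ed -> V) (K : fieldType) (conj : K -> K).
Hypothesis conjP : field_involution conj.
Local Notation T := (lterm V Ed K).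
Local Notation U := (ulpa s r K).
Local Notation uv := (uv s r K).
Local Notation inj := (inj s r).
Implicit Types (S : T -> Prop) (x y e f : T).

Lemma homogP x : homogeneous s r x <-> homog (inj x).
Proof.
split=> [[n hx]|[n /hom_spn[t ht /injP xt]]]; exists n; first exact: spn_hom.
by apply: hom_eq ht _; apply: leq_sym.
Qed.

Lemma vertex_idem v : idem s r (LV v : T).
Proof. exact: leq_vv. Qed.
Lemma vertex_hom v : homogeneous s r (LV v : T).
Proof. by exists 0; constructor. Qed.
Lemma vertex_proj v : proj s r conj (LV v : T).
Proof. by split; [exact: vertex_idem|exact: Defs.leq_refl]. Qed.

Lemma weak_Baer_of_corners :
  (forall v S, (forall x, S x -> corner s r (LV v) x /\ homogeneous s r x) ->
    exists f, [/\ idem s r f, corner s r (LV v) f &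
      forall y, rann_in s r (LV v) S y <-> rgen_in s r (LV v) f y]) ->
  weak_Baer s r K.
Proof.
move=> h v S hS; have [|f [/injP ff cf hf]] := h v (fun x => S (inj x)).
  move=> x /hS[hx vx]; split; last by apply/homogP; exists 0.
  by apply/injP; rewrite !injM.
rewrite injM in ff; exists (inj f); split=> //.
  move=> x Sx; have [/spn_any/mem_spn/memP[t xt] _] := hS x Sx; subst x.
  have [_ fS] : rann_in s r (LV v) (fun x => S (inj x)) f.
    by apply/hf; exists f; split=> //; apply/injP; rewrite injM ff.
  by rewrite -injM -(inj0 s r K); apply/injP/fS.
move=> y /memP[t ->] vt hy.
have /hf[z [_ /injP tz]] : rann_in s r (LV v) (fun x => S (inj x)) t.
  split; first by apply/injP; rewrite !injM vt.
  by move=> x Sx; apply/injP; rewrite injM hy.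
by rewrite tz injM mulrA ff.
Qed.

(** The generator [f] of the annihilator in the whole ring is cut down to the corner as [v f v]. *)
Lemma weak_Baer_of_ring :
  (forall S, (forall x, S x -> homogeneous s r x) ->
    exists f, idem s r f /\ forall y, rann s r S y <-> rgen s r f y) ->
  weak_Baer s r K.
Proof.
move=> h v S hS; have [|f [/injP ff hf]] := h (fun x => S (inj x)).
  by move=> x /hS[hx _]; apply/homogP; exists 0.
rewrite injM in ff; exists (uv v * inj f * uv v); split.
- by rewrite -mulrA; apply: memMl.
- move=> x Sx; have [/spn_any/mem_spn/memP[t xt] vx] := hS x Sx; subst x.
  have fS : rann s r (fun x => S (inj x)) f.
    by apply/hf; exists f; apply/injP; rewrite injM ff.
  have xf : inj t * inj f = 0 by rewrite -injM -(inj0 s r K); apply/injP/fS.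
  rewrite !mulrA; have -> : inj t * uv v = inj t by rewrite -vx -mulrA uvv.
  by rewrite xf mul0r.
move=> y /memP[t ->] vt hy.
have /hf[z /injP tz] : rann s r (fun x => S (inj x)) t.
  by move=> x Sx; apply/injP; rewrite injM hy.
have ft : inj f * inj t = inj t by rewrite tz injM mulrA ff.
have vt' : uv v * inj t = inj t by rewrite -vt !mulrA uvv.
by rewrite -!mulrA vt' ft vt'.
Qed.

(** The unit is absorbed by a finite sum of vertices, which annihilates every vertex outside the
    sum; vertices are nonzero. *)
Lemma unital_finite : unital s r K -> exists l : list V, forall v, List.In v l.
Proof.
move=> [u hu]; have [F0 hF] := local_unit (mem_inj s r u).
have [|_ uF] := hF (undup F0) (undup_uniq _); first by move=> v; rewrite mem_undup.
exists (undup F0) => v; have [/injP uvE _] := hu (LV v); rewrite injM -/(uv v) in uvE.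
have vF : v \in undup F0.
  apply: contrapT => /negP nv; apply: (@uv_neq0 _ _ s r K v).
  rewrite -uvE -uF -mulrA /vsum mulr_suml big1_seq ?mulr0 // => w /andP[_ wF].
  by apply: uvw => wv; rewrite -wv wF in nv.
elim: (undup F0) vF => //= w F IH; rewrite in_cons => /orP[/eqP->|/IH h]; first by left.
by right.
Qed.

Lemma finite_unit : finite_graph s -> exists u, [/\
  forall x, inj u * inj x = inj x /\ inj x * inj u = inj x,
  homogeneous s r u & proj s r conj u].
Proof.
move=> [_ [l hl]].
pose F := undup l; have uF : uniq F by apply: undup_uniq.
have F_all v : v \in F.
  rewrite mem_undup; have := hl v; elim: (l) => //= w l' IH [->|/IH h].
    by rewrite mem_head.
  by rewrite in_cons h orbT.
have hunit x : vsum s r K F * inj x = inj x /\ inj x * vsum s r K F = inj x.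
  by have [F0 hF] := local_unit (mem_inj s r x); apply: hF.
have h0 : spn (Mon s r (eq 0)) (vsum s r K F) by apply: spn_sum => v; apply: spn_uv.
have [u hu eu] := hom_spn h0; rewrite eu in hunit; exists u; split=> //; first by exists 0.
split; first by apply/injP; rewrite injM; case: (hunit u).
apply/injP; rewrite -ustar_inj // -eu ustar_sum //; apply: eq_bigr => v _.
exact: ustar_uv.
Qed.

Lemma corner_unit u : (forall x, inj u * inj x = inj x /\ inj x * inj u = inj x) ->
  forall S f, (forall y, rann_in s r u S y <-> rgen_in s r u f y) ->
  forall y, rann s r S y <-> rgen s r f y.
Proof.
move=> hu S f h y.
have cu x : corner s r u x by apply/injP; rewrite !injM; have [-> ->] := hu x.
split=> [hy|[z hz]]; first by have /h[z [_ hz]] : rann_in s r u S y by []; exists z.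
by have /h[] : rgen_in s r u f y by exists z.
Qed.

Lemma Baer_of_good : (forall v, good s r v) -> locally_Baer s r K.
Proof.
move=> ag e ee S hS.
have [f [_ h1 h2 h3]] :=
  corner_transfer ag (@splits_any _ _ _ _ K ag (fun u => exists2 x, S x & u = inj x)) I ee.
by exists f.
Qed.

Lemma graded_Baer_of_good : (forall v, good s r v) -> graded_locally_Baer s r K.
Proof.
move=> ag e ee he S hS.
have hSu (x : U) : (exists2 x', S x' & x = inj x') -> homog x.
  by move=> [x' /hS[_ /homogP] h ->].
have ee' := ee; move/injP: ee'; rewrite injM => ee'.
have he0 := homog_idem ag (proj1 (homogP e) he) ee'.
have [f [h0 h1 h2 h3]] := corner_transfer ag (splits_graded ag hSu) he0 ee.
by exists f; split=> //; split=> //; split=> //; apply/homogP; exists 0.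
Qed.

Lemma graded_Baer_star_of_good : positive_definite conj -> (forall v, good s r v) ->
  graded_locally_Baer_star s r conj.
Proof.
move=> pos ag e [ee se] he S hS.
have hSu (x : U) : (exists2 x', S x' & x = inj x') -> homog x.
  by move=> [x' /hS[_ /homogP] h ->].
have ee' := ee; move/injP: ee'; rewrite injM => ee'.
have he0 := homog_idem ag (proj1 (homogP e) he) ee'.
have se' : ustar conj (inj e) = inj e by rewrite ustar_inj //; apply/injP.
have [f [[h0 sf] h1 h2 h3]] :=
  corner_transfer ag (splits_star conjP ag pos hSu) (Logic.conj he0 se') ee.
exists f; split=> //; split; last by split=> //; apply/homogP; exists 0.
by split=> //; apply/injP; rewrite -ustar_inj.
Qed.

Let C1 := row_finite s /\ no_exit s r /\ all_inf_paths_end s r.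
Let C1' := finite_graph s /\ no_exit s r.

Lemma good_of_C1 : C1 -> forall v, good s r v.
Proof. by move=> [h1 [h2 h3]] v; apply: C1_good. Qed.
Lemma good_of_C1' : C1' -> forall v, good s r v.
Proof. by move=> [h1 h2] v; apply: finite_good. Qed.

Lemma C1_of_weak : weak_Baer s r K -> C1.
Proof.
move=> WB; split; first exact: weak_Baer_row_finite WB.
by split; [apply: weak_Baer_no_exit WB|apply: weak_Baer_paths_end WB].
Qed.
Lemma C1'_of_weak : weak_Baer s r K -> unital s r K -> C1'.
Proof.
move=> WB /unital_finite hl; split; last exact: weak_Baer_no_exit WB.
by split=> //; apply: weak_Baer_row_finite WB.
Qed.

Lemma unit_unital u : (forall x, inj u * inj x = inj x /\ inj x * inj u = inj x) ->
  unital s r K.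
Proof. by move=> h; exists u => x; split; apply/injP; rewrite injM; case: (h x). Qed.

(** The definition of a graded Baer star ring does not mention a unit. The annihilator of the empty
    set yields a left identity, and self-adjointness makes it two-sided. *)
Lemma star_unital : graded_Baer_star_ring s r conj -> unital s r K.
Proof.
move=> h; have [|f [[/injP ff sf] [_ hf]]] := h (fun _ => False); first by [].
rewrite injM in ff.
have hl x : inj f * inj x = inj x.
  have /hf[z /injP ->] : rann s r (fun _ => False) x by [].
  by rewrite injM mulrA ff.
have sf' : ustar conj (inj f) = inj f by rewrite ustar_inj //; apply/injP.
apply: (@unit_unital f) => x; split=> //.
have := hl (lstar conj x); rewrite -ustar_inj // => /(congr1 (ustar conj)).
by rewrite ustarM // !ustarK // sf'.
Qed.

Lemma Baer_equivalences :
  (C1 <-> locally_Baer s r K) /\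
  (C1 <-> graded_locally_Baer s r K) /\
  (positive_definite conj -> (C1 <-> graded_locally_Baer_star s r conj)) /\
  (C1' <-> Baer_ring s r K) /\
  (C1' <-> graded_Baer_ring s r K) /\
  (positive_definite conj -> (C1' <-> graded_Baer_star_ring s r conj)).
Proof.
split.
  split=> [/good_of_C1|h]; first exact: Baer_of_good.
  apply/C1_of_weak/weak_Baer_of_corners => v S hS.
  have [|f [h1 [h2 h3]]] := h _ (vertex_idem v) S; first by move=> x /hS[].
  by exists f.
split.
  split=> [/good_of_C1|h]; first exact: graded_Baer_of_good.
  apply/C1_of_weak/weak_Baer_of_corners => v S hS.
  have [f [h1 [h2 [_ h3]]]] := h _ (vertex_idem v) (vertex_hom v) S hS.
  by exists f.
split=> [pos|].
  split=> [/good_of_C1|h]; first exact: graded_Baer_star_of_good.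
  apply/C1_of_weak/weak_Baer_of_corners => v S hS.
  have [f [h1 [[h2 _] [_ h3]]]] := h _ (vertex_proj v) (vertex_hom v) S hS.
  by exists f.
split.
  split=> [hC|[hu h]].
    have [u [hu _ [uu _]]] := finite_unit hC.1; split; first exact: unit_unital hu.
    move=> S; have [|f [_ [h2 h3]]] := Baer_of_good (good_of_C1' hC) uu (S := S).
      by move=> x _; apply/injP; rewrite !injM; have [-> ->] := hu x.
    by exists f; split=> //; apply: corner_unit hu _ _ h3.
  by apply: C1'_of_weak hu; apply: weak_Baer_of_ring => S _; apply: h.
split.
  split=> [hC|[hu h]].
    have [u [hu u0 [uu _]]] := finite_unit hC.1; split; first exact: unit_unital hu.
    move=> S hS.
    have [|f [_ [h2 [h4 h3]]]] := graded_Baer_of_good (good_of_C1' hC) uu u0 (S := S).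
      move=> x Sx; split; last exact: hS.
      by apply/injP; rewrite !injM; have [-> ->] := hu x.
    by exists f; split=> //; split=> //; apply: corner_unit hu _ _ h3.
  apply: C1'_of_weak hu; apply: weak_Baer_of_ring => S hS.
  by have [f [h1 [_ h2]]] := h S hS; exists f.
move=> pos; split=> [hC|h].
  have [u [hu u0 pu]] := finite_unit hC.1 => S hS.
  have [|f [_ [h2 [h4 h3]]]] := graded_Baer_star_of_good pos (good_of_C1' hC) pu u0 (S := S).
    move=> x Sx; split; last exact: hS.
    by apply/injP; rewrite !injM; have [-> ->] := hu x.
  by exists f; split=> //; split=> //; apply: corner_unit hu _ _ h3.
apply: C1'_of_weak (star_unital h); apply: weak_Baer_of_ring => S hS.
by have [f [[h1 _] [_ h2]]] := h S hS; exists f.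
Qed.
End Transfer.

Theorem mainTheorem14 (V Ed : Type) (s r : Ed -> V) (K : fieldType)
    (conj : K -> K) (Hconj : field_involution conj) :
  let C1 := row_finite s /\ no_exit s r /\ all_inf_paths_end s r in
  let C1' := finite_graph s /\ no_exit s r in
  (C1 <-> locally_Baer s r K) /\
  (C1 <-> graded_locally_Baer s r K) /\
  (positive_definite conj -> (C1 <-> graded_locally_Baer_star s r conj)) /\
  (C1' <-> Baer_ring s r K) /\
  (C1' <-> graded_Baer_ring s r K) /\
  (positive_definite conj -> (C1' <-> graded_Baer_star_ring s r conj)).
(* [classicType V] equips [V] with classical equality and choice, used above for duplicate-free
   lists of vertices. *)
Proof. exact: (@Baer_equivalences (classicType V) Ed s r K conj Hconj). Qed.
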